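(* Let $f,\hat f_0,\hat f_1,\hat f_2,f_0,f_1,f_2:M\to\mathcal{Z}$ be Legendre maps of an $m$-manifold $M$ such that, for all $i,j,k$ with $\{i,j,k\}=\{0,1,2\}$, the maps $f,\hat f_i,f_j,\hat f_k$ form a Bianchi quadrilateral (with $f,f_j$ one pair of opposite vertices and $\hat f_i,\hat f_k$ the other). Assume that, for all distinct $i,j,k\in\{0,1,2\}$ and at every point of $M$, $$\hat f_i\not\subset\hat f_j\oplus\hat f_k,\qquad f_i\cap f_j=\{0\},\qquad f_i\not\subset f_j\oplus f_k.$$ Then there is a unique Legendre map $\hat f:M\to\mathcal{Z}$ which is a simultaneous Ribaucour transform of $f_0$, $f_1$ and $f_2$.
   Context: All manifolds, maps and bundles are smooth. $\mathbb{R}^{m+2,2}$ is an $(m+4)$-dimensional real vector space with metric $(\,,\,)$ of signature $(m+2,2)$; $\mathcal{Q}$ is its projective light-cone (the set of null lines) and $\mathcal{Z}$ the Grassmannian of null (totally isotropic) $2$-planes. A map of $M$ into a Grassmannian is identified with the corresponding subbundle of $M\times\mathbb{R}^{m+2,2}$; $\Gamma f$ denotes sections. A sphere congruence is a map $s:M\to\mathcal{Q}$. A map $f:M\to\mathcal{Z}$ is Legendre if $(\mathrm{d}\sigma_0,\sigma_1)\equiv0$ for all $\sigma_0,\sigma_1\in\Gamma f$; it envelops $s$ if $s(p)\subset f(p)$ for all $p$. If two pointwise distinct Legendre maps $f,\hat f$ envelop a common sphere congruence $s=f\cap\hat f$, let $\mathcal{N}_{f,\hat f}=(f+\hat f)/s\subset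 s^\perp/s$, on which the metric has signature $(1,1)$, let $\pi:s^\perp/s\to\mathcal{N}_{f,\hat f}$ be orthogonal projection, and let $\nabla^{f,\hat f}(\nu+s)=\pi(\mathrm{d}\nu+s)$ for $\nu\in\Gamma(f+\hat f)$; this is a metric connection. $(f,\hat f)$ is a Ribaucour pair (and $f,\hat f$ are Ribaucour transforms of each other) if $\nabla^{f,\hat f}$ is flat. Four Legendre maps $g_0,\hat g_0,g_1,\hat g_1$ form a Bianchi quadrilateral (opposite vertices $g_0,g_1$ and $\hat g_0,\hat g_1$) if each $(g_a,\hat g_b)$, $a,b\in\{0,1\}$, is a Ribaucour pair, the sphere congruences $g_0\cap\hat g_0$ and $g_0\cap\hat g_1$ are pointwise distinct, and $g_0,g_1$ are pointwise distinct. In this case $\hat g_0\oplus\hat g_1=g_0\oplus g_1$ is a bundle of $(2,2)$-planes. *)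

(* Defs.v *)
From HB Require Import structures.
From mathcomp Require Import all_boot all_order all_algebra.
From mathcomp Require Import all_classical all_reals all_analysis.

Set Implicit Arguments.
Unset Strict Implicit.
Unset Printing Implicit Defensive.

Import Order.TTheory GRing.Theory Num.Theory.
Import numFieldNormedType.Exports.
Local Open Scope classical_set_scope.
Local Open Scope ring_scope.

(* MathComp-Analysis, over an arbitrary R : realType. *)

(* C^oo on an open set [U] of R^m: every iterated directional derivative is
   Frechet differentiable at every point of [U]. *)
Definition iterD (R : realType) (m n : nat) (vs : seq 'rV[R]_m)
    (F : 'rV[R]_m -> 'rV[R]_n) : 'rV[R]_m -> 'rV[R]_n :=
  foldr (fun v G => 'D_v G) F vs.

Definition smooth (R : realType) (m n : nat) (U : set 'rV[R]_m)
    (F : 'rV[R]_m -> 'rV[R]_n) : Prop :=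
  forall (vs : seq 'rV[R]_m) (x : 'rV[R]_m), U x -> differentiable (iterD vs F) x.

(* Only the values of [coord] on [dom], and of [cinv] on [coord @` dom],
   are meaningful. *)
Record chart (R : realType) (m : nat) (T : topologicalType) := Chart {
  dom : set T;
  coord : T -> 'rV[R]_m;
  cinv : 'rV[R]_m -> T;
  dom_open : open dom;
  img_open : open (coord @` dom);
  coordK : forall p : T, dom p -> cinv (coord p) = p;
  coord_cont : forall p : T, dom p -> {for p, continuous coord};
  cinv_cont : forall x : 'rV[R]_m, (coord @` dom) x -> {for x, continuous cinv}
}.

Record manifold (R : realType) (m : nat) := Manifold {
  carrier :> topologicalType;
  atlas : set (chart R m carrier);
  hausdorff_carrier : hausdorff_space carrier;
  countable_carrier : @second_countable carrier;
  atlas_cover : forall p : carrier, exists2 c, atlas c & dom c p;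
  atlas_compat : forall c c' : chart R m carrier, atlas c -> atlas c' ->
    smooth (coord c @` (dom c `&` dom c')) (coord c' \o cinv c)
}.
Arguments atlas {R m} _.

Section LieSphereGeometry.
Variables (R : realType) (m : nat) (M : manifold R m).

(* R^{m+2,2} in pseudo-orthonormal coordinates. *)
Local Notation V := ('rV[R]_(m + 2 + 2)).

Definition metric (x y : V) : R :=
  \sum_(i < m + 2) x 0 (lshift 2 i) * y 0 (lshift 2 i)
  - \sum_(i < 2) x 0 (rshift (m + 2) i) * y 0 (rshift (m + 2) i).

Definition isotropic (U : {vspace V}) : Prop :=
  forall x y : V, x \in U -> y \in U -> metric x y = 0.

Definition perp (x : V) (U : {vspace V}) : Prop :=
  forall y : V, y \in U -> metric x y = 0.

(* Smoothness on an open subset [W] of the manifold. *)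
Definition smooth_on (W : set M) (sigma : M -> V) : Prop :=
  forall c, atlas M c -> smooth (coord c @` (W `&` dom c)) (sigma \o cinv c).

(* Derivative at [p] along the tangent vector whose components in the chart
   [c] are [v]. *)
Definition dchart (c : chart R m M) (v : 'rV[R]_m) (sigma : M -> V) (p : M) : V :=
  'D_v (sigma \o cinv c) (coord c p).

(* A smooth map into the Grassmannian of k-planes, seen as a rank k subbundle:
   it has smooth local frames. *)
Definition smooth_bundle (k : nat) (F : M -> {vspace V}) : Prop :=
  (forall p : M, \dim (F p) = k) /\
  forall p : M, exists (W : set M) (sigma : 'I_k -> M -> V),
    [/\ open W, W p, forall i, smooth_on W (sigma i) &
        forall q : M, W q -> F q = <<[seq sigma i q | i : 'I_k]>>%VS].

(* Local sections: values of [sigma] outside the open set [W] are irrelevant. *)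
Definition section_on (W : set M) (F : M -> {vspace V}) (sigma : M -> V) : Prop :=
  smooth_on W sigma /\ forall p : M, W p -> sigma p \in F p.

Definition null_bundle (k : nat) (F : M -> {vspace V}) : Prop :=
  smooth_bundle k F /\ forall p : M, isotropic (F p).

Definition sphere_congruence (s : M -> {vspace V}) : Prop := null_bundle 1 s.

Definition Legendre (f : M -> {vspace V}) : Prop :=
  null_bundle 2 f /\
  forall (W : set M) (sigma0 sigma1 : M -> V), open W ->
    section_on W f sigma0 -> section_on W f sigma1 ->
  forall c, atlas M c -> forall (v : 'rV[R]_m) (p : M), W p -> dom c p ->
    metric (dchart c v sigma0 p) (sigma1 p) = 0.

Definition envelops (f s : M -> {vspace V}) : Prop :=
  forall p : M, (s p <= f p)%VS.

Definition pointwise_distinct (F G : M -> {vspace V}) : Prop :=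
  forall p : M, F p <> G p.

Definition bundle_sum (F G : M -> {vspace V}) : M -> {vspace V} :=
  fun p => (F p + G p)%VS.

Definition bundle_cap (F G : M -> {vspace V}) : M -> {vspace V} :=
  fun p => (F p :&: G p)%VS.

(* Sections of (f + fh)/s are handled through representatives in f + fh,
   s = f :&: fh.  [nabla f fh c v W nu mu] says that
     nabla_v (nu + s) = pi (d_v nu + s) = mu + s   on W,
   where v stands for the vector field with constant components v in the chart
   c: as pi is the orthogonal projection of s^perp/s onto (f + fh)/s, this means
   that mu lies in f + fh and that d_v nu - mu is orthogonal to f + fh.  It
   determines mu modulo s. *)
Definition nabla (f fh : M -> {vspace V}) (c : chart R m M) (v : 'rV[R]_m)
    (W : set M) (nu mu : M -> V) : Prop :=
  [/\ section_on W (bundle_sum f fh) nu, section_on W (bundle_sum f fh) mu &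
      forall p : M, W p -> perp (dchart c v nu p - mu p) (bundle_sum f fh p)].

(* Vanishing of the curvature of nabla,
     R(u, v) = nabla_u nabla_v - nabla_v nabla_u - nabla_[u, v],
   evaluated on vector fields with constant components in a chart, for which
   [u, v] = 0; as R is a tensor these determine it. *)
Definition nabla_flat (f fh : M -> {vspace V}) : Prop :=
  forall c, atlas M c -> forall (W : set M), open W -> W `<=` dom c ->
  forall (u v : 'rV[R]_m) (nu nu_u nu_v nu_uv nu_vu : M -> V),
    nabla f fh c u W nu nu_u -> nabla f fh c v W nu nu_v ->
    nabla f fh c u W nu_v nu_uv -> nabla f fh c v W nu_u nu_vu ->
  forall p : M, W p -> nu_uv p - nu_vu p \in bundle_cap f fh p.

Definition Ribaucour_pair (f fh : M -> {vspace V}) : Prop :=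
  [/\ Legendre f, Legendre fh, pointwise_distinct f fh,
      exists s : M -> {vspace V}, [/\ sphere_congruence s, envelops f s,
        envelops fh s & s = bundle_cap f fh] &
      nabla_flat f fh].

(* g0, g1 are opposite vertices, and so are gh0, gh1. *)
Definition Bianchi_quadrilateral (g0 gh0 g1 gh1 : M -> {vspace V}) : Prop :=
  [/\ Ribaucour_pair g0 gh0 /\ Ribaucour_pair g0 gh1,
      Ribaucour_pair g1 gh0 /\ Ribaucour_pair g1 gh1,
      pointwise_distinct (bundle_cap g0 gh0) (bundle_cap g0 gh1) &
      pointwise_distinct g0 g1].

End LieSphereGeometry.

(* Main.v *)
(* The twelve lines in which adjacent planes of the cube meet give all the data.
   The lines [fh_i :&: f_j], i <> j, form a hexagon in which neighbours are
   orthogonal.  They have local sections e_ij, unique up to a common factor, such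
   that e_ij + e_ik spans [f :&: fh_i] and the six e_ij add up to 0.  Put
   rho_j = e_ij + e_kj, a section of f_j.  Then rho_0 + rho_1 + rho_2 = 0, so
   rho_j spans the line [f_j :&: (f_i + f_k)]; the rho_j are null and hence
   mutually orthogonal, so they span a null plane, and a Ribaucour transform of
   f_0, f_1, f_2 can only be this plane.
   For a derivation d, the pairings (d e_ij, e_kl) of neighbours vanish because
   the fh_i and the f_j are Legendre; together with the relation
   (d(e_ij + e_ik), e_ji + e_jk) = 0 for f and the vanishing of the sum of the
   e_ij, this forces (d rho_j, rho_k) = 0 by linear algebra.
   Finally the connection of the pair (f, fh_j) and that of the new pair (f_j, fh)
   have the same connection forms (d e_ij, e_jk) / (e_ij, e_jk) and
   (d e_jk, e_ij) / (e_ij, e_jk), so that flatness of the first gives flatness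
   of the second. *)

From Pilot Require Import Defs.
From HB Require Import structures.
From mathcomp Require Import all_boot all_order all_algebra.
From mathcomp Require Import all_classical all_reals all_analysis.
From mathcomp Require Import ring lra.
Import Order.TTheory GRing.Theory Num.Theory.
Import numFieldNormedType.Exports.
(* [coord] and [iterD] also name MathComp lemmas. *)
Import Pilot.Defs.
Set Implicit Arguments.
Unset Strict Implicit.
Unset Printing Implicit Defensive.
Local Open Scope classical_set_scope.
Local Open Scope ring_scope.

(** * Smooth functions *)

Section Differentiation.
Variable R : realType.
Implicit Types X E : normedModType R.

(** Differentiability depends only on the germ: the first-order expansion of [f] at [x] is also one
    for [g], and uniqueness of the linear part identifies the differentials. *)
Lemma near_eq_differentiable X E (f g : X -> E) (x : X) :
  {near x, f =1 g} -> differentiable f x -> differentiable g x.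
Proof.
move=> fg df; have fgx : f x = g x := nbhs_singleton fg.
have ex : g \o shift x = cst (g x) + 'd f x +o_ 0 id.
  apply/eqaddoP => e e0; have /eqaddoP/(_ e e0) H := diff_locally df.
  have sh : \forall h \near (0 : X), f (h + x) = g (h + x).
    by move: fg; rewrite (near_shift 0) /= subr0.
  apply: filterS2 sh H => h fgh; rewrite !fctE /= fgh fgx.
  exact.
have dfg : 'd g x = 'd f x :> (X -> E).
  by apply: diff_unique => //; apply: diff_continuous.
apply/diff_locallyP; rewrite dfg; split => //.
exact: diff_continuous.
Qed.

(** One notion covers the product of scalars, scalar multiplication, the metric and the pairing in
    the chain rule, so that a single Leibniz rule serves for all of them. *)
Definition continuous_bilinear E1 E2 E3 (B : E1 -> E2 -> E3) : Prop :=
  [/\ forall y, linear (B^~ y), forall x, linear (B x) &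
      continuous (fun p : E1 * E2 => B p.1 p.2)].

Lemma differentiable_bilinear X E1 E2 E3 (B : E1 -> E2 -> E3)
    (F : X -> E1) (G : X -> E2) (x : X) :
  continuous_bilinear B -> differentiable F x -> differentiable G x ->
  differentiable (fun y => B (F y) (G y)) x /\
  forall v, 'D_v (fun y => B (F y) (G y)) x =
            B ('D_v F x) (G x) + B (F x) ('D_v G x).
Proof.
move=> [Bl Br Bc] dF dG.
have Bb : bilinear_for (GRing.Scale.Law.clone _ _ *:%R _)
            (GRing.Scale.Law.clone _ _ *:%R _) B by split=> [y|y] a u v; [apply: Bl|apply: Br].
pose BM := bilinear_isBilinear.Build R E1 E2 E3 _ _ B Bb.
pose BB : {bilinear E1 -> E2 -> E3} := HB.pack B BM.
have dB := @differentiable_bilin R E1 E2 E3 BB (F x, G x) Bc.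
have dp := differentiable_pair dF dG.
have dd := differentiable_comp dp dB.
split=> [//|v].
rewrite (deriveE v (dd : differentiable (fun y => B (F y) (G y)) x)).
rewrite (deriveE v dF) (deriveE v dG).
have db := @diff_bilin R E1 E2 E3 BB (F x, G x) Bc.
transitivity (('d (fun p : E1 * E2 => BB p.1 p.2) (F x, G x) \o
               'd (fun y => (F y, G y)) x) v); first by rewrite -(diff_comp dp dB).
rewrite [LHS]/comp (diff_pair dF dG) db.
by rewrite /= addrC.
Qed.

Lemma scale_continuous_bilinear E :
  continuous_bilinear (fun (a : R) (x : E) => a *: x).
Proof.
split=> [y a u v|x a u v|]; last exact: scale_continuous.
- by rewrite scalerDl -scalerA.
- by rewrite scalerDr !scalerA mulrC.
Qed.

(* [C^n] on [U] in the sense of [smooth], by recursion on the order so that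
   product and chain rules follow by induction. *)
Fixpoint Cn X E (n : nat) (U : set X) (F : X -> E) : Prop :=
  (forall x, U x -> differentiable F x) /\
  (if n is n'.+1 then forall v, Cn n' U ('D_v F) else True).

Lemma Cn_differentiable X E n (U : set X) (F : X -> E) x :
  Cn n U F -> U x -> differentiable F x.
Proof. by case: n => [|n] [H _]; apply: H. Qed.

Lemma CnW X E n (U : set X) (F : X -> E) : Cn n.+1 U F -> Cn n U F.
Proof.
elim: n F => [|n IH] F [dF DF]; split=> // v.
by apply: IH; apply: DF.
Qed.

Lemma Cn_subset X E n (U U' : set X) (F : X -> E) :
  U' `<=` U -> Cn n U F -> Cn n U' F.
Proof.
move=> sU; elim: n F => [|n IH] F [dF DF]; split=> //; try by move=> x /sU /dF.
by move=> v; apply: IH; apply: DF.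
Qed.

Lemma eq_on_near X E (U : set X) (F G : X -> E) x : open U ->
  {in U, F =1 G} -> U x -> {near x, F =1 G}.
Proof.
move=> oU FG Ux; have := open_nbhs_nbhs (conj oU Ux).
by apply: filterS => y Uy; apply: FG; rewrite inE.
Qed.

Lemma eq_on_derive X E (U : set X) (F G : X -> E) x v : open U ->
  {in U, F =1 G} -> U x -> 'D_v F x = 'D_v G x.
Proof. by move=> oU FG Ux; apply: near_eq_derive; apply: eq_on_near FG Ux. Qed.

Lemma eq_on_Cn X E n (U : set X) (F G : X -> E) : open U ->
  {in U, F =1 G} -> Cn n U F -> Cn n U G.
Proof.
move=> oU; elim: n F G => [|n IH] F G FG [dF DF].
  split=> // x Ux; apply: near_eq_differentiable (dF x Ux).
  exact: eq_on_near FG Ux.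
split=> [x Ux|v].
  by apply: near_eq_differentiable (dF x Ux); apply: eq_on_near FG Ux.
apply: IH (DF v) => x; rewrite inE => Ux; exact: eq_on_derive FG Ux.
Qed.

Lemma Cn_cst X E n (U : set X) (a : E) : Cn n U (cst a).
Proof.
elim: n a => [|n IH] a; split=> //; try by move=> x _; apply: differentiable_cst.
move=> v; have -> : 'D_v (cst a) = cst (0 : E).
  by apply/funext => x; rewrite derive_cst.
exact: IH.
Qed.

Lemma CnD X E n (U : set X) (F G : X -> E) : open U ->
  Cn n U F -> Cn n U G -> Cn n U (fun x => F x + G x).
Proof.
move=> oU; elim: n F G => [|n IH] F G [dF DF] [dG DG]; split=> //;
  try by move=> x Ux; apply: differentiableD; [apply: dF|apply: dG].
move=> v; apply: eq_on_Cn (IH _ _ (DF v) (DG v)) => // x; rewrite inE => Ux.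
by rewrite -deriveD //; apply: diff_derivable; [apply: dF|apply: dG].
Qed.

(** By the Leibniz rule a derivative of [B F G] is a sum of two terms of the same shape, to which
    the induction hypothesis applies. *)
Lemma Cn_bilinear X E1 E2 E3 (B : E1 -> E2 -> E3) n (U : set X) F G :
  continuous_bilinear B -> open U ->
  Cn n U F -> Cn n U G -> Cn n U (fun x => B (F x) (G x)).
Proof.
move=> cB oU; elim: n F G => [|n IH] F G CF CG.
  split=> // x Ux.
  by have [] := differentiable_bilinear cB (Cn_differentiable CF Ux) (Cn_differentiable CG Ux).
split=> [x Ux|v].
  by have [] := differentiable_bilinear cB (Cn_differentiable CF Ux) (Cn_differentiable CG Ux).
have C1 := IH _ _ (CF.2 v) (CnW CG).
have C2 := IH _ _ (CnW CF) (CG.2 v).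
apply: eq_on_Cn (CnD oU C1 C2) => // x; rewrite inE => Ux.
by have [_ ->] := differentiable_bilinear cB (Cn_differentiable CF Ux) (Cn_differentiable CG Ux).
Qed.

Lemma CnZ X E n (U : set X) (a : X -> R) (F : X -> E) : open U ->
  Cn n U a -> Cn n U F -> Cn n U (fun x => a x *: F x).
Proof. exact: Cn_bilinear (@scale_continuous_bilinear E). Qed.

(** The derivative of [a^-1] is [- a^-1 * a^-1 * 'D_v a], a product of functions that are already
    known to be of class [n] by induction. *)
Lemma CnV X n (U : set X) (a : X -> R) : open U ->
  (forall x, U x -> a x != 0) -> Cn n U a -> Cn n U (fun x => (a x)^-1).
Proof.
move=> oU a0; elim: n => [|n IH] Ca.
  by split=> // x Ux; apply: differentiableV; [apply: Cn_differentiable Ca Ux|apply: a0].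
split=> [x Ux|v].
  by apply: differentiableV; [apply: Cn_differentiable Ca Ux|apply: a0].
have Ci := IH (CnW Ca).
have C := CnZ oU (CnZ oU (Cn_cst n U (-1 : R)) (CnZ oU Ci Ci)) (Ca.2 v).
apply: eq_on_Cn C => // x; rewrite inE => Ux.
rewrite deriveV ?a0 //; last by apply: diff_derivable; apply: Cn_differentiable Ca Ux.
by congr (_ *: _); rewrite /GRing.scale /= mulN1r -invfM -expr2.
Qed.

Lemma Cn_sum X E n (U : set X) (I : Type) (r : seq I) (F : I -> X -> E) :
  open U -> (forall i, Cn n U (F i)) -> Cn n U (fun x => \sum_(i <- r) F i x).
Proof.
move=> oU CF; elim: r => [|i r IH].
  by apply: eq_on_Cn (Cn_cst n U (0 : E)) => // x _; rewrite big_nil.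
by apply: eq_on_Cn (CnD oU (CF i) IH) => // x _; rewrite big_cons.
Qed.

(** The chain rule in coordinates: partial derivatives of [F] in fixed directions are again
    functions composed with [G], which lets [Cn_comp] proceed by induction. *)
Lemma derive_comp_row X E m (F : 'rV[R]_m -> E) (G : X -> 'rV[R]_m) x v :
  differentiable G x -> differentiable F (G x) ->
  'D_v (F \o G) x = \sum_(i < m) 'D_v G x 0 i *: 'D_(delta_mx 0 i) F (G x).
Proof.
move=> dG dF; rewrite deriveE; last exact: differentiable_comp.
rewrite diff_comp //= -(deriveE v dG).
rewrite [X in 'd F _ X = _](row_sum_delta ('D_v G x)) linear_sum /=.
by apply: eq_bigr => i _; rewrite linearZ /= -deriveE.
Qed.

Lemma coord_scale_continuous_bilinear E m (i : 'I_m) :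
  continuous_bilinear (fun (w : 'rV[R]_m) (x : E) => w 0 i *: x).
Proof.
split=> [y a u v|w a u v|p].
- by rewrite !mxE scalerDl -scalerA.
- by rewrite scalerDr !scalerA mulrC.
- apply: (@cvgZ _ _ _ _ _ (fun q : 'rV[R]_m * E => q.1 0 i) snd); last exact: cvg_snd.
  apply: (@continuous_comp _ _ _ (fst : 'rV[R]_m * E -> _)
            (fun w : 'rV[R]_m => w 0 i));
    first exact: cvg_fst.
  exact: coord_continuous.
Qed.

Lemma Cn_comp X E m n (U : set X) (U' : set 'rV[R]_m)
    (F : 'rV[R]_m -> E) (G : X -> 'rV[R]_m) : open U ->
  (forall x, U x -> U' (G x)) -> Cn n U G -> Cn n U' F -> Cn n U (F \o G).
Proof.
move=> oU GU.
have dFG k (F' : 'rV[R]_m -> E) : Cn k U G -> Cn k U' F' ->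
    forall x, U x -> differentiable (F' \o G) x.
  move=> CG CF x Ux; apply: differentiable_comp.
    exact: Cn_differentiable CG Ux.
  exact: Cn_differentiable CF (GU _ Ux).
elim: n F => [|n IH] F CG CF; split=> //; try exact: dFG CG CF.
move=> v.
have C i : Cn n U (fun x => 'D_v G x 0 i *: 'D_(delta_mx 0 i) F (G x)).
  apply: (Cn_bilinear (coord_scale_continuous_bilinear E i)) => //.
    exact: CG.2.
  apply: (IH ('D_(delta_mx 0 i) F)); [exact: CnW CG|exact: CF.2].
apply: eq_on_Cn (Cn_sum _ oU C) => // x; rewrite inE => Ux.
rewrite derive_comp_row //; first exact: Cn_differentiable CG Ux.
exact: Cn_differentiable CF (GU _ Ux).
Qed.

Lemma iterD_rcons m n (vs : seq 'rV[R]_m) v (F : 'rV[R]_m -> 'rV[R]_n) :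
  iterD (rcons vs v) F = iterD vs ('D_v F).
Proof. by rewrite /iterD foldr_rcons. Qed.

(** [Cn] takes the innermost derivative first, whereas [iterD] adds derivatives on the outside;
    hence the induction on the list from its end. *)
Lemma smoothP m n (U : set 'rV[R]_m) (F : 'rV[R]_m -> 'rV[R]_n) :
  smooth U F <-> forall k, Cn k U F.
Proof.
split=> [sF k|CF vs].
  elim: k F sF => [|k IH] F sF; split=> //; try exact: (sF [::]).
  by move=> v; apply: IH => vs x Ux; rewrite -iterD_rcons; apply: sF.
elim/last_ind: vs F CF => [|vs v IH] F CF x Ux.
  exact: Cn_differentiable (CF 0) Ux.
by rewrite iterD_rcons; apply: IH => // k; exact: (CF k.+1).2.
Qed.

End Differentiation.

(** * Derivatives on a manifold *)

Section ManifoldCalculus.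
Variables (R : realType) (m : nat) (M : manifold R m).
Implicit Types (E : normedModType R) (W : set M) (c : chart R m M).
Local Notation V := ('rV[R]_(m + 2 + 2)).

Lemma metricC (x y : V) : metric x y = metric y x.
Proof. by rewrite /metric; congr (_ - _); apply: eq_bigr => i _; rewrite mulrC. Qed.

Lemma metric_linear (x : V) : linear (metric x : V -> R).
Proof.
move=> a y z; rewrite /metric /GRing.scale /= mulrBr addrACA -opprD.
by congr (_ - _); rewrite mulr_sumr -big_split; apply: eq_bigr => i _ /=;
  rewrite !mxE mulrDr mulrCA.
Qed.

HB.instance Definition _ (x : V) :=
  GRing.isLinear.Build R V R *%R (metric x) (metric_linear x).

Lemma metric0r (x : V) : metric x 0 = 0. Proof. exact: linear0. Qed.
Lemma metric0l (x : V) : metric 0 x = 0. Proof. by rewrite metricC metric0r. Qed.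
Lemma metricDr (x y z : V) : metric x (y + z) = metric x y + metric x z.
Proof. exact: linearD. Qed.
Lemma metricDl (x y z : V) : metric (y + z) x = metric y x + metric z x.
Proof. by rewrite !(metricC _ x) metricDr. Qed.
Lemma metricNr (x y : V) : metric x (- y) = - metric x y.
Proof. exact: linearN. Qed.
Lemma metricNl (x y : V) : metric (- y) x = - metric y x.
Proof. by rewrite !(metricC _ x) metricNr. Qed.
Lemma metricBl (x y z : V) : metric (y - z) x = metric y x - metric z x.
Proof. by rewrite metricDl metricNl. Qed.
Lemma metricZr (x y : V) a : metric x (a *: y) = a * metric x y.
Proof. exact: linearZ. Qed.
Lemma metricZl (x y : V) a : metric (a *: y) x = a * metric y x.
Proof. by rewrite !(metricC _ x) metricZr. Qed.

Lemma metric_continuous_bilinear : continuous_bilinear (@metric R m).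
Proof.
split=> [y a u v|x|p]; [by rewrite metricDl metricZl|exact: metric_linear|].
have cM (i : 'I_(m + 2 + 2)) :
    {for p, continuous (fun q : V * V => q.1 0 i * q.2 0 i)}.
  apply: (@continuousM _ _ (fun q : V * V => q.1 0 i) (fun q : V * V => q.2 0 i)).
    by apply: (@continuous_comp _ _ _ (fst : V * V -> V) (fun w : V => w 0 i));
      [exact: cvg_fst|exact: coord_continuous].
  by apply: (@continuous_comp _ _ _ (snd : V * V -> V) (fun w : V => w 0 i));
    [exact: cvg_snd|exact: coord_continuous].
have cS n (F : 'I_n -> 'I_(m + 2 + 2)) :
    {for p, continuous (fun q : V * V => \sum_(i < n) q.1 0 (F i) * q.2 0 (F i))}.
  elim: n F => [|n IH] F.
    have -> : (fun q : V * V => \sum_(i < 0) q.1 0 (F i) * q.2 0 (F i)) = cst 0.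
      by apply/funext => q; rewrite big_ord0.
    exact: cst_continuous.
  have -> : (fun q : V * V => \sum_(i < n.+1) q.1 0 (F i) * q.2 0 (F i)) =
     (fun q : V * V => q.1 0 (F ord0) * q.2 0 (F ord0)) +
     (fun q : V * V => \sum_(i < n) q.1 0 (F (lift ord0 i)) * q.2 0 (F (lift ord0 i))).
    by apply/funext => q; rewrite big_ord_recl.
  by apply: continuousD; [apply: cM|apply: IH].
exact: (@continuousB _ _ _
  (fun q : V * V => \sum_(i < m + 2) q.1 0 (lshift 2 i) * q.2 0 (lshift 2 i))).
Qed.

Lemma chart_image_open W c : open W -> open (coord c @` (W `&` dom c)).
Proof.
move=> oW; rewrite openE => _ [p [Wp dp] <-].
have ip : (coord c @` dom c) (coord c p) by exists p.
have nW : nbhs (cinv c (coord c p)) W.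
  by rewrite coordK //; apply: open_nbhs_nbhs.
have := cinv_cont ip nW; rewrite nbhs_filterE /= => nci.
have := open_nbhs_nbhs (conj (@img_open _ _ _ c) ip) => nim.
apply: filterS (filterI nci nim) => x [/= Wx [q dq qx]].
by exists q => //; split=> //; move: Wx; rewrite -qx /= coordK.
Qed.

(** Allows any normed module as target, because coefficients and connection forms are scalar while
    sections are vectors. *)
Definition smooth_map E W (F : M -> E) : Prop :=
  forall c, atlas M c -> forall k, Cn k (coord c @` (W `&` dom c)) (F \o cinv c).

Lemma smooth_onP W (sigma : M -> V) : smooth_on W sigma <-> smooth_map W sigma.
Proof. by split=> sF c Ac; apply/smoothP; apply: sF. Qed.

Definition Dchart E c (v : 'rV[R]_m) (F : M -> E) (p : M) : E :=
  'D_v (F \o cinv c) (coord c p).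

Section Rules.
Variable E : normedModType R.
Implicit Types F G : M -> E.

Lemma smooth_map_subset W W' F : W' `<=` W -> smooth_map W F -> smooth_map W' F.
Proof.
move=> sW sF c Ac k; apply: Cn_subset (sF c Ac k) => x [p [W'p dp] <-].
by exists p => //; split=> //; apply: sW.
Qed.

Lemma eq_on_chart W c F G : {in W, F =1 G} ->
  {in coord c @` (W `&` dom c), F \o cinv c =1 G \o cinv c}.
Proof.
move=> FG x; rewrite inE => -[p [Wp dp] <-] /=.
by rewrite coordK // FG // inE.
Qed.

Lemma eq_on_Dchart W c v F G p : open W -> {in W, F =1 G} -> W p -> dom c p ->
  Dchart c v F p = Dchart c v G p.
Proof.
move=> oW FG Wp dp.
rewrite /Dchart (eq_on_derive v (chart_image_open (c := c) oW) (eq_on_chart (c := c) FG)) //.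
by exists p.
Qed.

Lemma smooth_map_cst W (a : E) : smooth_map W (cst a).
Proof. by move=> c Ac k; apply: Cn_cst. Qed.

Lemma Dchart_cst c v (a : E) p : Dchart c v (cst a) p = 0.
Proof. exact: derive_cst. Qed.

Lemma smooth_mapD W F G : open W -> smooth_map W F -> smooth_map W G ->
  smooth_map W (fun p => F p + G p).
Proof.
by move=> oW sF sG c Ac k; apply: CnD; [apply: chart_image_open|apply: sF|apply: sG].
Qed.

Lemma smooth_map_differentiable W c F p : smooth_map W F -> atlas M c ->
  W p -> dom c p -> differentiable (F \o cinv c) (coord c p).
Proof. by move=> sF Ac Wp dp; apply: Cn_differentiable (sF c Ac 0) _; exists p. Qed.

Lemma DchartD W c v F G p : smooth_map W F -> smooth_map W G ->
    atlas M c -> W p -> dom c p ->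
  Dchart c v (fun p => F p + G p) p = Dchart c v F p + Dchart c v G p.
Proof.
move=> sF sG Ac Wp dp; apply: deriveD; apply: diff_derivable;
  exact: smooth_map_differentiable Ac Wp dp.
Qed.

(** A derivative taken in the chart [c] and read in another chart [c'] is a derivative on the
    coordinate space of [c] composed with the transition map, which is smooth by compatibility of
    the atlas. *)
Lemma smooth_Dchart W c v F : W `<=` dom c -> atlas M c ->
  open W -> smooth_map W F -> smooth_map W (Dchart c v F).
Proof.
move=> sW Ac oW sF c' Ac' k.
apply: (@Cn_comp R _ E m k _ (coord c @` (W `&` dom c))
          ('D_v (F \o cinv c)) (coord c \o cinv c')).
- exact: chart_image_open.
- move=> _ [p [Wp dp] <-] /=; rewrite coordK //.
  by exists p => //; split=> //; apply: sW.
- have /smoothP /(_ k) := atlas_compat Ac' Ac.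
  by apply: Cn_subset => _ [p [Wp dp] <-]; exists p => //; split=> //; apply: sW.
- exact: (sF c Ac k.+1).2.
Qed.

End Rules.

Section Bilinear.
Variables (E1 E2 E3 : normedModType R) (B : E1 -> E2 -> E3).
Hypothesis cB : continuous_bilinear B.

Lemma smooth_map_bilinear W F G : open W -> smooth_map W F -> smooth_map W G ->
  smooth_map W (fun p => B (F p) (G p)).
Proof.
move=> oW sF sG c Ac k.
apply: (Cn_bilinear (F := F \o cinv c) (G := G \o cinv c) cB).
- exact: chart_image_open.
- exact: sF.
- exact: sG.
Qed.

Lemma Dchart_bilinear W c v F G p : smooth_map W F -> smooth_map W G ->
    atlas M c -> W p -> dom c p ->
  Dchart c v (fun p => B (F p) (G p)) p =
  B (Dchart c v F p) (G p) + B (F p) (Dchart c v G p).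
Proof.
move=> sF sG Ac Wp dp.
have [_] := differentiable_bilinear cB (smooth_map_differentiable sF Ac Wp dp)
              (smooth_map_differentiable sG Ac Wp dp).
by move=> /(_ v); rewrite /= !coordK.
Qed.

End Bilinear.

End ManifoldCalculus.

(* Sealed, because unification would otherwise unfold derivatives. *)
HB.lock Definition dscal (R : realType) (m : nat) (M : manifold R m)
  (c : chart R m M) (v : 'rV[R]_m) (a : M -> R) : M -> R := Dchart c v a.

(** * Calculus rules for scalar functions and for maps into the ambient space *)

Section ScalarAndVectorRules.
Variables (R : realType) (m : nat) (M : manifold R m).
Implicit Types (W : set M) (c : chart R m M).
Local Notation V := ('rV[R]_(m + 2 + 2)).

Lemma dscalE c v (a : M -> R) : dscal c v a = Dchart c v a.
Proof. by rewrite unlock. Qed.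

Lemma smooth_map_add W (a b : M -> R) : open W ->
  smooth_map W a -> smooth_map W b -> smooth_map W (fun p => a p + b p).
Proof. exact: (@smooth_mapD R m M R W a b). Qed.

Lemma smooth_map_addv W (F G : M -> V) : open W ->
  smooth_map W F -> smooth_map W G -> smooth_map W (fun p => F p + G p).
Proof. exact: (@smooth_mapD R m M V W F G). Qed.

Lemma smooth_map_mul W (a b : M -> R) : open W ->
  smooth_map W a -> smooth_map W b -> smooth_map W (fun p => a p * b p).
Proof. exact: (smooth_map_bilinear (@scale_continuous_bilinear R R)). Qed.

Lemma smooth_map_scale W (a : M -> R) (F : M -> V) :
  open W -> smooth_map W a -> smooth_map W F -> smooth_map W (fun p => a p *: F p).
Proof. exact: (smooth_map_bilinear (@scale_continuous_bilinear R V)). Qed.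

Lemma smooth_map_metric W (F G : M -> V) :
  open W -> smooth_map W F -> smooth_map W G ->
  smooth_map W (fun p => metric (F p) (G p)).
Proof. exact: (smooth_map_bilinear (@metric_continuous_bilinear R m)). Qed.

Lemma smooth_dscal W c v (a : M -> R) : W `<=` dom c -> atlas M c ->
  open W -> smooth_map W a -> smooth_map W (dscal c v a).
Proof. by rewrite dscalE; apply: smooth_Dchart. Qed.

Lemma smooth_dchart W c v (F : M -> V) : W `<=` dom c -> atlas M c ->
  open W -> smooth_map W F -> smooth_map W (dchart c v F).
Proof. exact: smooth_Dchart. Qed.

Lemma eq_on_dscal W c v (a b : M -> R) p : open W -> {in W, a =1 b} ->
  W p -> dom c p -> dscal c v a p = dscal c v b p.
Proof. by rewrite !dscalE; apply: eq_on_Dchart. Qed.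

Lemma eq_on_dchart W c v (F G : M -> V) p : open W -> {in W, F =1 G} ->
  W p -> dom c p -> dchart c v F p = dchart c v G p.
Proof. exact: eq_on_Dchart. Qed.

Lemma dscal_cst c v (a : R) p : dscal c v (cst a) p = 0.
Proof. by rewrite dscalE; exact: Dchart_cst. Qed.

Lemma dchart_cst c v (x : V) p : dchart c v (cst x) p = 0.
Proof. exact: Dchart_cst. Qed.

Section DerivativeRules.
Variables (W : set M) (c : chart R m M) (v : 'rV[R]_m).
Hypothesis Ac : atlas M c.

Lemma dscalD (a b : M -> R) p : smooth_map W a -> smooth_map W b -> W p -> dom c p ->
  dscal c v (fun q => a q + b q) p = dscal c v a p + dscal c v b p.
Proof. by rewrite !dscalE => sa sb Wp; apply: (DchartD v sa sb Ac Wp). Qed.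

Lemma dchartD (F G : M -> V) p : smooth_map W F -> smooth_map W G -> W p -> dom c p ->
  dchart c v (fun q => F q + G q) p = dchart c v F p + dchart c v G p.
Proof. by move=> sF sG Wp; apply: (DchartD v sF sG Ac Wp). Qed.

Lemma dscalM (a b : M -> R) p : smooth_map W a -> smooth_map W b -> W p -> dom c p ->
  dscal c v (fun q => a q * b q) p = dscal c v a p * b p + a p * dscal c v b p.
Proof.
by rewrite !dscalE => sa sb; apply: (Dchart_bilinear (@scale_continuous_bilinear R R) v sa sb Ac).
Qed.

Lemma dchartZ (a : M -> R) (F : M -> V) p :
    smooth_map W a -> smooth_map W F -> W p -> dom c p ->
  dchart c v (fun q => a q *: F q) p = dscal c v a p *: F p + a p *: dchart c v F p.
Proof.
by rewrite dscalE => sa sF; apply: (Dchart_bilinear (@scale_continuous_bilinear R V) v sa sF Ac).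
Qed.

Lemma dscal_metric (F G : M -> V) p :
    smooth_map W F -> smooth_map W G -> W p -> dom c p ->
  dscal c v (fun q => metric (F q) (G q)) p =
  metric (dchart c v F p) (G p) + metric (F p) (dchart c v G p).
Proof.
by rewrite dscalE => sF sG; apply: (Dchart_bilinear (@metric_continuous_bilinear R m) v sF sG Ac).
Qed.

End DerivativeRules.

Lemma smooth_mapV W (a : M -> R) : open W -> (forall p, W p -> a p != 0) ->
  smooth_map W a -> smooth_map W (fun p => (a p)^-1).
Proof.
move=> oW a0 sa c Ac k; apply: (CnV (a := a \o cinv c)).
- exact: chart_image_open.
- by move=> _ [p [Wp dp] <-] /=; rewrite coordK // a0.
- exact: sa.
Qed.

End ScalarAndVectorRules.

(** * Null planes *)

Section IsotropicPlanes.
Variables (R : realType) (m : nat).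
Local Notation V := ('rV[R]_(m + 2 + 2)).
Implicit Types (U g : {vspace V}) (u v w x : V).

(** The metric is positive definite on the vectors whose two negative coordinates vanish. *)
Lemma definite_isotropic_eq0 x : metric x x = 0 -> rsubmx x = 0 -> x = 0.
Proof.
move=> xx x2; rewrite -(hsubmxK x) x2.
have x2E i : x 0 (rshift (m + 2) i) = 0.
  by have /matrixP/(_ 0 i) := x2; rewrite !mxE.
suff -> : lsubmx x = 0 by rewrite row_mx0.
have s0 : \sum_(i < m + 2) x 0 (lshift 2 i) * x 0 (lshift 2 i) = 0.
  move: xx; rewrite /metric [X in _ - X]big1 ?subr0 // => i _.
  by rewrite x2E mul0r.
apply/rowP => i; rewrite !mxE; apply/eqP; rewrite -sqrf_eq0 expr2.
by move/eqP: s0; rewrite psumr_eq0 => [/allP/(_ i (mem_index_enum _))|j _] //; exact: sqr_ge0.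
Qed.

(** Otherwise [U + <[x]>] would be isotropic of dimension 3. Its projection to the two negative
    coordinates has a nonzero kernel, on which the metric is definite. *)
Lemma isotropic_maximal U x : isotropic U -> \dim U = 2%N ->
  metric x x = 0 -> perp x U -> x \in U.
Proof.
move=> iU dU xx xU; apply/negPn/negP => xNU.
have iU' : isotropic (U + <[x]>).
  move=> _ _ /memv_addP[u uU [_ /vlineP[a ->] ->]] /memv_addP[w wU [_ /vlineP[b ->] ->]].
  rewrite !(metricDl, metricDr, metricZl, metricZr) iU // (xU w wU).
  by rewrite metricC (xU u uU) xx !(mulr0, addr0).
have dU' : \dim (U + <[x]>) = 3%N.
  rewrite dimv_disjoint_sum ?dU ?dim_vline.
    by case: eqVneq xNU => // ->; rewrite mem0v.
  apply/eqP; rewrite -subv0; apply/subvP => y /memv_capP[yU /vlineP[a ya]].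
  rewrite memv0 ya scaler_eq0; apply/orP; left; apply: contraNT xNU => a0.
  by have := memvZ a^-1 yU; rewrite ya scalerA mulVf // scale1r.
pose h : 'Hom(V, 'rV[R]_2) := linfun rsubmx.
have := limg_ker_dim h (U + <[x]>); rewrite dU' => dimE.
have : (\dim (h @: (U + <[x]>)) <= 2)%N.
  by have := dimvS (subvf (h @: (U + <[x]>))%VS); rewrite dimvf /dim /= mul1n.
move=> le2; have : (0 < \dim ((U + <[x]>) :&: lker h))%N.
  by rewrite lt0n; apply/eqP => z; move: le2; rewrite -[X in (X <= _)%N]add0n -[X in (X + _)%N]z dimE.
rewrite lt0n dimv_eq0 => k0.
have /memv_capP[wU wk] := memv_pick ((U + <[x]>) :&: lker h).
move: k0; rewrite -vpick0; case/eqP; apply: definite_isotropic_eq0; first exact: iU'.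
by move: wk; rewrite memv_ker lfunE /= => /eqP.
Qed.

Lemma notin_vline u v : v != 0 -> u \notin <[v]>%VS -> u != 0 /\ v \notin <[u]>%VS.
Proof.
move=> v0 uv; have u0 : u != 0 by apply: contraNneq uv => ->; rewrite mem0v.
split=> //; apply: contraNN uv => /vlineP[a va]; apply/vlineP; exists a^-1.
rewrite va scalerA mulVf ?scale1r //; apply: contraNneq v0 => a0.
by rewrite va a0 scale0r.
Qed.

Lemma plane_span U u v : \dim U = 2%N -> u \in U -> v \in U ->
  v != 0 -> u \notin <[v]>%VS -> U = (<[u]> + <[v]>)%VS.
Proof.
move=> dU uU vU v0 uv; have [u0 _] := notin_vline v0 uv.
apply/esym/eqP; rewrite eqEdim subv_add -!memvE uU vU dU dimv_disjoint_sum.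
  by rewrite !dim_vline u0 v0.
apply/eqP; rewrite -subv0; apply/subvP => y /memv_capP[/vlineP[a ya] yv].
rewrite memv0 ya scaler_eq0; apply/orP; left; apply: contraNT uv => a0.
by have := memvZ a^-1 yv; rewrite ya scalerA mulVf // scale1r.
Qed.

Lemma mem_plane u v x : x \in (<[u]> + <[v]>)%VS ->
  exists a b, x = a *: u + b *: v.
Proof. by move=> /memv_addP[_ /vlineP[a ->] [_ /vlineP[b ->] ->]]; exists a, b. Qed.

Lemma mem_planel u v : u \in (<[u]> + <[v]>)%VS.
Proof. exact: (subvP (addvSl _ _)) (memv_line u). Qed.

Lemma mem_planer u v : v \in (<[u]> + <[v]>)%VS.
Proof. exact: (subvP (addvSr _ _)) (memv_line v). Qed.

Lemma plane_dim u v : v != 0 -> u \notin <[v]>%VS -> \dim (<[u]> + <[v]>) = 2%N.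
Proof.
move=> v0 uv; have [u0 _] := notin_vline v0 uv.
rewrite dimv_disjoint_sum ?dim_vline ?u0 ?v0 //.
apply/eqP; rewrite -subv0; apply/subvP => y /memv_capP[/vlineP[a ya] yv].
rewrite memv0 ya scaler_eq0; apply/orP; left; apply: contraNT uv => a0.
by have := memvZ a^-1 yv; rewrite ya scalerA mulVf // scale1r.
Qed.

Lemma line_eq U u : \dim U = 1%N -> u \in U -> u != 0 -> U = <[u]>%VS.
Proof.
move=> dU uU u0; apply/esym/eqP.
by rewrite eqEdim -memvE uU dU dim_vline u0.
Qed.

(** A proper subspace of a plane has dimension at most 1, so any nonzero vector in it spans it. *)
Lemma line_of_proper U U' u : \dim U = 2%N -> ~~ (U <= U')%VS ->
  u \in (U :&: U')%VS -> u != 0 -> (U :&: U')%VS = <[u]>%VS.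
Proof.
move=> dU NUU' uUU' u0; apply: line_eq => //.
have le2 : (\dim (U :&: U') <= 1)%N.
  suff : (\dim (U :&: U') < \dim U)%N by rewrite dU.
  rewrite ltn_neqAle dimvS ?capvSl // andbT.
  apply: contra NUU' => dE; apply/capv_idPl/eqP.
  by rewrite eqEdim capvSl (eqP dE) leqnn.
have := dimvS (_ : <[u]> <= U :&: U')%VS; rewrite -memvE dim_vline u0 => /(_ uUU').
by move=> ge1; apply/eqP; rewrite eqn_leq le2.
Qed.

(* Opposite edges of a quadrilateral of null planes are not orthogonal:
   otherwise [t1], hence the line [g0 :&: gh1], and then also [t0], would lie
   in [g0 :&: g1] by maximality of null planes. *)
Lemma quadrilateral_nonorthogonal g0 gh0 g1 gh1 s0 s1 t0 t1 :
    isotropic g0 -> isotropic g1 -> isotropic gh0 -> isotropic gh1 ->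
    \dim g0 = 2%N -> \dim g1 = 2%N ->
    (g0 :&: gh0 = <[s0]>)%VS -> (g0 :&: gh1 = <[s1]>)%VS ->
    s0 != 0 -> s1 != 0 -> t0 != 0 -> t1 != 0 ->
    t0 \in (g1 :&: gh0)%VS -> t1 \in (g1 :&: gh1)%VS ->
    (g0 :&: gh0)%VS <> (g0 :&: gh1)%VS -> g0 <> g1 ->
  metric s0 t1 != 0.
Proof.
move=> i0 i1 ih0 ih1 d0 d1 E0 E1 s00 s10 t00 t10 /memv_capP[t0g t0h] /memv_capP[t1g t1h] ns ng.
apply/eqP => st.
have /memv_capP[s0g s0h] : s0 \in (g0 :&: gh0)%VS by rewrite E0 memv_line.
have /memv_capP[s1g s1h] : s1 \in (g0 :&: gh1)%VS by rewrite E1 memv_line.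
have s01 : s0 \notin <[s1]>%VS.
  apply/negP => /vlineP[a s0E]; apply: ns; rewrite E0 E1.
  apply/eqP; rewrite eqEdim !dim_vline s00 s10 leqnn andbT -memvE.
  by apply/vlineP; exists a.
have span0 := plane_span d0 s0g s1g s10 s01.
have in0 t : metric t t = 0 -> metric s0 t = 0 -> metric s1 t = 0 -> t \in g0.
  move=> tt t_s0 t_s1; apply: isotropic_maximal => // y.
  rewrite span0 => /mem_plane[a [b ->]].
  by rewrite metricDr !metricZr !(metricC t) t_s0 t_s1 !mulr0 addr0.
have swap t s g : t != 0 -> t \in g -> t \in <[s]>%VS -> s \in g.
  move=> tn0 tg /vlineP[a tE]; have a0 : a != 0.
    by apply: contraNneq tn0 => a0; rewrite tE a0 scale0r.
  by have := memvZ a^-1 tg; rewrite tE scalerA mulVf // scale1r.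
have t1s : t1 \in <[s1]>%VS.
  by rewrite -E1 memv_cap t1h andbT; apply: in0 => //; [apply: i1|apply: ih1].
have s1g1 := swap _ _ _ t10 t1g t1s.
have t0s : t0 \in <[s0]>%VS.
  rewrite -E0 memv_cap t0h andbT.
  by apply: in0; [apply: i1|apply: ih0|apply: i1].
have s0g1 := swap _ _ _ t00 t0g t0s.
by apply: ng; rewrite span0 -(plane_span d1 s0g1 s1g1 s10 s01).
Qed.

End IsotropicPlanes.

(** * Legendre maps and flatness *)

Section LegendreFrames.
Variables (R : realType) (m : nat) (M : manifold R m).
Local Notation V := ('rV[R]_(m + 2 + 2)).
Implicit Types (g gh : M -> {vspace V}) (W : set M) (c : chart R m M) (a b : M -> R).

Lemma dchart_orthogonal W c v (r r' : M -> V) p :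
    smooth_map W r -> smooth_map W r' -> open W ->
    (forall q, W q -> metric (r q) (r' q) = 0) ->
    atlas M c -> W p -> dom c p ->
  metric (r p) (dchart c v r' p) = - metric (dchart c v r p) (r' p).
Proof.
move=> sr sr' oW rr' Ac Wp dp; apply/eqP; rewrite -addr_eq0 addrC; apply/eqP.
rewrite -(dscal_metric v Ac sr sr' Wp dp).
have rr0 : {in W, (fun q => metric (r q) (r' q)) =1 cst 0}.
  by move=> q; rewrite inE => Wq; apply: rr'.
by rewrite (eq_on_dscal v oW rr0 Wp dp) dscal_cst.
Qed.

Lemma Legendre_dchart g W c v (r r' : M -> V) p : Legendre g -> open W ->
    smooth_map W r -> smooth_map W r' ->
    (forall q, W q -> r q \in g q) -> (forall q, W q -> r' q \in g q) ->
    atlas M c -> W p -> dom c p ->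
  metric (dchart c v r p) (r' p) = 0.
Proof.
move=> [_ Lg] oW sr sr' rg r'g Ac Wp dp.
by apply: (Lg W r r' oW _ _ c Ac v p Wp dp); split=> //; apply/smooth_onP.
Qed.

(** A single pairing of frame sections suffices: the other three follow by differentiating the
    isotropy relations. *)
Lemma Legendre_of_frame g : null_bundle 2 g ->
  (forall p, exists W (r0 r1 : M -> V),
     [/\ open W /\ W p, smooth_map W r0, smooth_map W r1,
         forall q, W q -> g q = (<[r0 q]> + <[r1 q]>)%VS &
         forall c v q, atlas M c -> W q -> dom c q ->
           metric (dchart c v r0 q) (r1 q) = 0]) ->
  Legendre g.
Proof.
move=> ng frames; split=> // W' s0 s1 oW'.
move=> [/smooth_onP ss0 s0g] [/smooth_onP ss1 s1g] c Ac v p W'p dp.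
have [W [r0 [r1 [[oW Wp] sr0 sr1 gE Lr]]]] := frames p.
have r0g q : W q -> r0 q \in g q.
  by move=> Wq; rewrite gE // mem_planel.
have r1g q : W q -> r1 q \in g q.
  by move=> Wq; rewrite gE // mem_planer.
have iso q x y : x \in g q -> y \in g q -> metric x y = 0 by apply: ng.2.
have self (r : M -> V) : smooth_map W r -> (forall q, W q -> r q \in g q) ->
    metric (r p) (dchart c v r p) = 0.
  move=> sr rg; have := dchart_orthogonal v sr sr oW
    (fun q Wq => iso q _ _ (rg q Wq) (rg q Wq)) Ac Wp dp.
  by rewrite [metric (dchart _ _ _ _) _]metricC => /eqP; rewrite -addr_eq0 -mulr2n mulrn_eq0 /= => /eqP.
have r01 := dchart_orthogonal v sr0 sr1 oW (fun q Wq => iso q _ _ (r0g q Wq) (r1g q Wq)) Ac Wp dp.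
rewrite Lr // oppr0 in r01.
have r10 : metric (r1 p) (dchart c v r0 p) = 0 by rewrite metricC Lr.
(* Moving the derivative from [s0] to the frame section [r] leaves only the value of [s0] at [p] to
   be expanded, so no coefficient function has to be differentiated. *)
have s0D (r : M -> V) : smooth_map W r -> (forall q, W q -> r q \in g q) ->
    metric (r0 p) (dchart c v r p) = 0 -> metric (r1 p) (dchart c v r p) = 0 ->
    metric (dchart c v s0 p) (r p) = 0.
  move=> sr rg r0r r1r; apply/eqP; rewrite -oppr_eq0; apply/eqP.
  have ss0' : smooth_map (W' `&` W) s0 by exact: smooth_map_subset (@subIsetl _ _ _) ss0.
  have sr' : smooth_map (W' `&` W) r by exact: smooth_map_subset (@subIsetr _ _ _) sr.
  have s0r q : (W' `&` W) q -> metric (s0 q) (r q) = 0.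
    by move=> [W'q Wq]; apply: (iso q); [apply: s0g|apply: rg].
  have <- := dchart_orthogonal v ss0' sr' (openI oW' oW) s0r Ac (conj W'p Wp) dp.
  have := s0g p W'p; rewrite (gE p Wp) => /mem_plane[x [y ->]].
  by rewrite metricDl !metricZl r0r r1r !mulr0 addr0.
have D0 := s0D r0 sr0 r0g (self r0 sr0 r0g) r10.
have D1 := s0D r1 sr1 r1g r01 (self r1 sr1 r1g).
have := s1g p W'p; rewrite (gE p Wp) => /mem_plane[x [y ->]].
by rewrite metricDr !metricZr D0 D1 !mulr0 addr0.
Qed.

End LegendreFrames.

(* [f/s] and [fh/s] are dual null lines of the bundle [(f + fh)/s], spanned by
   [r] and [rh]; [connection c v r rh] is the connection form of the induced
   connection on [f/s]. *)
HB.lock Definition connection (R : realType) (m : nat) (M : manifold R m)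
  (c : chart R m M) (v : 'rV[R]_m) (r rh : M -> 'rV[R]_(m + 2 + 2)) : M -> R :=
  fun p => metric (dchart c v r p) (rh p) * (metric (r p) (rh p))^-1.

(** * Flatness of the induced connection in terms of connection forms *)

Section LegendreFlatness.
Variables (R : realType) (m : nat) (M : manifold R m).
Local Notation V := ('rV[R]_(m + 2 + 2)).
Implicit Types (g gh : M -> {vspace V}) (W : set M) (c : chart R m M) (a b : M -> R).

(** Here [rho] spans the common sphere congruence, while [r] and [rh] represent the two null lines
    of [(g + gh)/s]. *)
Definition adapted_frame g gh W (rho r rh : M -> V) : Prop :=
  [/\ smooth_map W rho, smooth_map W r, smooth_map W rh &
      forall q, W q -> [/\ g q = (<[rho q]> + <[r q]>)%VS,
        gh q = (<[rho q]> + <[rh q]>)%VS, (g q :&: gh q)%VS = <[rho q]>%VS &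
        metric (r q) (rh q) != 0]].

(** The exterior derivative of the 1-form [kappa] vanishes, tested on coordinate fields of [c],
    which commute. *)
Definition closed_on c W (kappa : 'rV[R]_m -> M -> R) : Prop :=
  forall u v p, W p -> dscal c u (kappa v) p = dscal c v (kappa u) p.

(** Symmetry of mixed second derivatives, kept as a predicate because [flat_closed] extracts it from
    a flat pair and [flat_of_closed] passes it on to another pair. *)
Definition symmetric_on c W : Prop :=
  forall a u v p, smooth_map W a -> W p ->
    dscal c u (dscal c v a) p = dscal c v (dscal c u a) p.

Lemma adapted_frame_swap g gh W rho r rh :
  adapted_frame g gh W rho r rh -> adapted_frame gh g W rho rh r.
Proof.
by move=> [? ? ? H]; split=> // q /H[? ? ? ?]; split=> //; rewrite 1?capvC 1?metricC.
Qed.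

Lemma adapted_frame_subset g gh W W' rho r rh : W' `<=` W ->
  adapted_frame g gh W rho r rh -> adapted_frame g gh W' rho r rh.
Proof.
move=> sW [? ? ? H]; split; try exact: smooth_map_subset sW _.
by move=> q /sW /H.
Qed.

Lemma smooth_connection g gh W rho r rh c v : adapted_frame g gh W rho r rh ->
  open W -> W `<=` dom c -> atlas M c -> smooth_map W (connection c v r rh).
Proof.
move=> [_ sr srh H] oW sW Ac; rewrite unlock; apply: smooth_map_mul => //.
  by apply: smooth_map_metric => //; apply: smooth_dchart.
apply: smooth_mapV => //; first by move=> q /H[].
exact: smooth_map_metric.
Qed.

Lemma connectionE c v (r rh : M -> V) p : connection c v r rh p =
  metric (dchart c v r p) (rh p) * (metric (r p) (rh p))^-1.
Proof. by rewrite unlock. Qed.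

Lemma nabla_flat_swap g gh : nabla_flat g gh -> nabla_flat gh g.
Proof.
have -> : nabla_flat gh g = nabla_flat g gh.
  have sE : bundle_sum gh g = bundle_sum g gh.
    by apply/funext => p; rewrite /bundle_sum addvC.
  have cE : bundle_cap gh g = bundle_cap g gh.
    by apply/funext => p; rewrite /bundle_cap capvC.
  by rewrite /nabla_flat /nabla sE cE.
by [].
Qed.

Section FlatFrame.
Variables (g gh : M -> {vspace V}) (W : set M) (rho r rh : M -> V) (c : chart R m M).
Hypotheses (Lg : Legendre g) (Lgh : Legendre gh).
Hypotheses (oW : open W) (sW : W `<=` dom c) (Ac : atlas M c).
Hypothesis ad : adapted_frame g gh W rho r rh.

Let sr : smooth_map W r. Proof. by case: ad. Qed.
Let srh : smooth_map W rh. Proof. by case: ad. Qed.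
Let srho : smooth_map W rho. Proof. by case: ad. Qed.
Let gE q : W q -> g q = (<[rho q]> + <[r q]>)%VS.
Proof. by case: ad => _ _ _ H /H[]. Qed.
Let ghE q : W q -> gh q = (<[rho q]> + <[rh q]>)%VS.
Proof. by case: ad => _ _ _ H /H[]. Qed.
Let capE q : W q -> (g q :&: gh q)%VS = <[rho q]>%VS.
Proof. by case: ad => _ _ _ H /H[]. Qed.
Let rrh q : W q -> metric (r q) (rh q) != 0.
Proof. by case: ad => _ _ _ H /H[]. Qed.
Let rg q : W q -> r q \in g q.
Proof. by move=> Wq; rewrite gE // mem_planer. Qed.
Let rhg q : W q -> rh q \in gh q.
Proof. by move=> Wq; rewrite ghE // mem_planer. Qed.
Let rhog q : W q -> rho q \in g q.
Proof. by move=> Wq; rewrite gE // mem_planel. Qed.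
Let rhogh q : W q -> rho q \in gh q.
Proof. by move=> Wq; rewrite ghE // mem_planel. Qed.
Let isog q : isotropic (g q). Proof. exact: Lg.1.2. Qed.
Let isogh q : isotropic (gh q). Proof. exact: Lgh.1.2. Qed.

(** The coefficient in [nabla_v (a r) = (d_v a + kappa_v a) r] modulo the common line. *)
Definition covariant v (a : M -> R) : M -> R :=
  fun p => dscal c v a p + connection c v r rh p * a p.

Let sconn v : smooth_map W (connection c v r rh).
Proof. exact: smooth_connection ad oW sW Ac. Qed.

Lemma smooth_covariant v a : smooth_map W a -> smooth_map W (covariant v a).
Proof.
move=> sa; apply: smooth_map_add => //; first exact: smooth_dscal.
exact: smooth_map_mul.
Qed.

(** The difference between [d_v (a r)] and [covariant v a *: r] is orthogonal to [g], hence to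
    [rho], because [g] is isotropic and Legendre; it is orthogonal to [rh] by the choice of the
    connection form. *)
Let nabla_scale v a : smooth_map W a ->
  nabla g gh c v W (fun q => a q *: r q) (fun q => covariant v a q *: r q).
Proof.
move=> sa.
have sec b : smooth_map W b -> section_on W (bundle_sum g gh) (fun q => b q *: r q).
  move=> sb; split; first by apply/smooth_onP; apply: smooth_map_scale.
  by move=> q Wq; rewrite -[_ *: _]addr0 memv_add ?mem0v // memvZ // rg.
split; [exact: sec|by apply: sec; apply: smooth_covariant|].
move=> q Wq y /memv_addP[y1 y1g [y2 y2g ->]].
rewrite (dchartZ v Ac sa sr Wq (sW Wq)).
have Drho := Legendre_dchart v Lg oW sr srho rg rhog Ac Wq (sW Wq).
have Dr := Legendre_dchart v Lg oW sr sr rg rg Ac Wq (sW Wq).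
rewrite metricDr.
have -> : metric (dscal c v a q *: r q + a q *: dchart c v r q -
                  covariant v a q *: r q) y1 = 0.
  have Dr1 : metric (dchart c v r q) y1 = 0.
    move: y1g; rewrite gE // => /mem_plane[x [y' ->]].
    by rewrite metricDr !metricZr Drho Dr !mulr0 addr0.
  by rewrite metricBl metricDl !metricZl Dr1 (isog (rg Wq) y1g) !mulr0 addr0 subr0.
move: y2g; rewrite ghE // => /mem_plane[x [y' ->]]; rewrite add0r metricDr !metricZr.
have -> : metric (dscal c v a q *: r q + a q *: dchart c v r q -
                  covariant v a q *: r q) (rho q) = 0.
  by rewrite metricBl metricDl !metricZl (isog (rg Wq) (rhog Wq)) Drho !mulr0 addr0 subr0.
rewrite mulr0 add0r metricBl metricDl !metricZl /covariant mulrDl connectionE.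
rewrite mulrAC divfK ?rrh // [a q * _]mulrC opprD addrACA !subrr addr0 mulr0.
by [].
Qed.

(** Flatness puts a multiple of [r] into the line of [rho]; pairing with [rh] kills [rho] but not
    [r], so the multiple is zero. *)
Lemma flat_covariant_commute : nabla_flat g gh ->
  forall a u v p, smooth_map W a -> W p ->
  covariant u (covariant v a) p = covariant v (covariant u a) p.
Proof.
move=> fl a u v p sa Wp.
have capp : bundle_cap g gh p = <[rho p]>%VS := capE Wp.
have := fl c Ac W oW sW u v _ _ _ _ _ (nabla_scale u sa) (nabla_scale v sa)
  (nabla_scale u (smooth_covariant v sa)) (nabla_scale v (smooth_covariant u sa)) p Wp.
rewrite capp -scalerBl => /vlineP[x xE].
have := congr1 (fun y => metric y (rh p)) xE.
rewrite /= !metricZl (isogh (rhogh Wp) (rhg Wp)) mulr0 => /eqP.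
by rewrite mulf_eq0 (negPf (rrh Wp)) orbF subr_eq0 => /eqP.
Qed.

(* Applying flatness to [r] gives [closed_on]; applying it to the sections
   [a *: r] for all functions [a] then also yields the symmetry of second
   derivatives. *)
Lemma flat_closed : nabla_flat g gh ->
  closed_on c W (fun v => connection c v r rh) /\ symmetric_on c W.
Proof.
move=> fl.
(* The final bracket is symmetric in [u] and [v], so it cancels when the two orders of
   differentiation are compared. *)
have expand a u v p : smooth_map W a -> W p ->
    covariant u (covariant v a) p =
    dscal c u (dscal c v a) p + dscal c u (connection c v r rh) p * a p
    + (connection c v r rh p * dscal c u a p + connection c u r rh p * dscal c v a p
    + connection c u r rh p * connection c v r rh p * a p).
  move=> sa Wp; have dp := sW Wp; rewrite [LHS]/covariant.
  have sD : smooth_map W (dscal c v a) by exact: smooth_dscal.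
  have sM : smooth_map W (fun q => connection c v r rh q * a q) by exact: smooth_map_mul.
  have -> : dscal c u (covariant v a) p = _ := dscalD u Ac sD sM Wp dp.
  rewrite (dscalM u Ac (sconn v) sa Wp dp) /covariant.
  by rewrite mulrDr mulrA -!addrA.
have cl : closed_on c W (fun v => connection c v r rh).
  move=> u v p Wp.
  have s1 := smooth_map_cst (M := M) W (1 : R).
  have D1 w : dscal c w (cst (1 : R)) = cst 0.
    by apply/funext => q; rewrite dscal_cst.
  have := flat_covariant_commute fl u v s1 Wp.
  rewrite (expand _ u v p s1 Wp) (expand _ v u p s1 Wp) !D1 !dscal_cst.
  by rewrite !mulr0 !add0r !mulr1 [X in _ = _ + X]mulrC => /addIr.
split=> // a u v p sa Wp.
have := flat_covariant_commute fl u v sa Wp.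
rewrite (expand _ u v p sa Wp) (expand _ v u p sa Wp) (cl u v p Wp).
by rewrite [connection c v r rh p * connection c u r rh p]mulrC
  [connection c v r rh p * dscal c u a p + _]addrC => /addIr /addIr.
Qed.

(** Among [rho], [r], [rh] the only nonzero pairing is that of [r] with [rh], so these two pairings
    of [w] detect its coefficients along [rh] and [r]. *)
Lemma mem_cap_orthogonal q w : W q -> w \in (g q + gh q)%VS ->
  metric w (r q) = 0 -> metric w (rh q) = 0 -> w \in (g q :&: gh q)%VS.
Proof.
move=> Wq; rewrite capE // gE // ghE // => /memv_addP[_ /mem_plane[a1 [b1 ->]] [_ /mem_plane[a2 [b2 ->]] ->]].
have rr : metric (r q) (r q) = 0 by apply: (isog (q := q)); apply: rg.
have rhrh : metric (rh q) (rh q) = 0 by apply: (isogh (q := q)); apply: rhg.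
have ro : metric (rho q) (r q) = 0 by apply: (isog (q := q)); [apply: rhog|apply: rg].
have roh : metric (rho q) (rh q) = 0 by apply: (isogh (q := q)); [apply: rhogh|apply: rhg].
rewrite !metricDl !metricZl rr rhrh ro roh [metric (rh q) _]metricC.
rewrite !mulr0 !add0r !addr0 => /eqP; rewrite mulf_eq0 (negPf (rrh Wq)) orbF => /eqP ->.
move=> /eqP; rewrite mulf_eq0 (negPf (rrh Wq)) orbF => /eqP ->.
by rewrite !scale0r !addr0 -scalerDl memvZ // memv_line.
Qed.

(* Pairing a section with [r] sees only its component along [rh], on which the
   connection form is minus that of the dual line. *)
Let nabla_pairing v nu mu : nabla g gh c v W nu mu ->
  forall q, W q -> metric (mu q) (r q) =
    dscal c v (fun q => metric (nu q) (r q)) q - connection c v r rh q * metric (nu q) (r q).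
Proof.
move=> [[/smooth_onP snu nug] [_ _] pe] q Wq.
have dq := sW Wq.
have Drho := Legendre_dchart v Lg oW sr srho rg rhog Ac Wq dq.
have Dr := Legendre_dchart v Lg oW sr sr rg rg Ac Wq dq.
have rgs : r q \in bundle_sum g gh q by rewrite (subvP (addvSl _ _)) // rg.
have := pe q Wq _ rgs; rewrite metricBl => /eqP; rewrite subr_eq0 => /eqP <-.
have := dscal_metric v Ac snu sr Wq dq.
move=> ->; rewrite -addrA -[LHS]addr0; congr (_ + _).
have := nug q Wq; rewrite /bundle_sum gE // ghE //.
move=> /memv_addP[_ /mem_plane[a1 [b1 ->]] [_ /mem_plane[a2 [b2 ->]] ->]].
have rr : metric (r q) (r q) = 0 by apply: (isog (q := q)); apply: rg.
have ro : metric (rho q) (r q) = 0 by apply: (isog (q := q)); [apply: rhog|apply: rg].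
rewrite !metricDl !metricZl rr ro ![metric _ (dchart c v r q)]metricC Drho Dr.
rewrite !mulr0 !add0r connectionE [metric (rh q) (r q)]metricC mulrCA.
by rewrite -mulrA [_^-1 * _]mulrC divff ?rrh // mulr1 subrr.
Qed.

(** Pairing with [r] turns the connection into the scalar operator [d - kappa], whose curvature
    vanishes since [kappa] is closed and second derivatives commute. *)
Lemma nabla_pairing_commute u v nu nu_u nu_v nu_uv nu_vu p :
  W p ->
  closed_on c W (fun v => connection c v r rh) -> symmetric_on c W ->
  nabla g gh c u W nu nu_u -> nabla g gh c v W nu nu_v ->
  nabla g gh c u W nu_v nu_uv -> nabla g gh c v W nu_u nu_vu ->
  metric (nu_uv p - nu_vu p) (r p) = 0.
Proof.
move=> Wp cl sy Nu Nv Nuv Nvu; have dp := sW Wp.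
pose phi q := metric (nu q) (r q).
have sphi : smooth_map W phi.
  have [[/smooth_onP snu _] _ _] := Nu.
  exact: smooth_map_metric.
have second w w' mu mu' : nabla g gh c w W nu mu -> nabla g gh c w' W mu mu' ->
    metric (mu' p) (r p) = dscal c w' (dscal c w phi) p
      - dscal c w' (connection c w r rh) p * phi p
      - (connection c w r rh p * dscal c w' phi p +
         connection c w' r rh p * dscal c w phi p)
      + connection c w r rh p * connection c w' r rh p * phi p.
  move=> N1 N2; rewrite (nabla_pairing N2 Wp).
  have E := nabla_pairing N1.
  have sD : smooth_map W (dscal c w phi).
    exact: smooth_dscal.
  have sk : smooth_map W (connection c w r rh) := sconn w.
  have sM : smooth_map W (fun q => connection c w r rh q * phi q) by exact: smooth_map_mul.
  have sN : smooth_map W (fun q => -1 * (connection c w r rh q * phi q)).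
    by apply: smooth_map_mul => //; apply: smooth_map_cst.
  have E' : {in W, (fun q => metric (mu q) (r q)) =1
      (fun q => dscal c w phi q + -1 * (connection c w r rh q * phi q))}.
    by move=> q; rewrite inE => Wq; rewrite E // mulN1r.
  rewrite (eq_on_dscal w' oW E' Wp dp) (dscalD w' Ac sD sN Wp dp).
  rewrite (dscalM w' Ac (smooth_map_cst W (-1 : R)) sM Wp dp) dscal_cst.
  rewrite (dscalM w' Ac sk sphi Wp dp) (E p Wp) -/(phi p).
  rewrite -/phi /cst; ring.
rewrite metricBl (second _ _ _ _ Nv Nuv) (second _ _ _ _ Nu Nvu).
rewrite (sy phi u v p sphi Wp) (cl u v p Wp); ring.
Qed.

End FlatFrame.

Lemma nabla_subset g gh c v W W' nu mu : W' `<=` W ->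
  nabla g gh c v W nu mu -> nabla g gh c v W' nu mu.
Proof.
have sec sigma : W' `<=` W -> section_on W (bundle_sum g gh) sigma ->
    section_on W' (bundle_sum g gh) sigma.
  move=> sW [/smooth_onP ss sg]; split; last by move=> q /sW /sg.
  exact/smooth_onP/(smooth_map_subset sW ss).
by move=> sW [s1 s2 H]; split; [exact: sec|exact: sec|move=> q /sW /H].
Qed.

Lemma nabla_swap g gh c v W nu mu :
  nabla g gh c v W nu mu -> nabla gh g c v W nu mu.
Proof.
suff sE : bundle_sum gh g = bundle_sum g gh by rewrite /nabla sE.
by apply/funext => p; rewrite /bundle_sum addvC.
Qed.

(** Flatness is local, so a frame may be used near each point. The curvature pairs to zero with [r]
    and, after exchanging [g] and [gh], with [rh]; hence it takes values in the common line. *)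
Lemma flat_of_closed g gh : Legendre g -> Legendre gh ->
  (forall p, exists W rho r rh,
     [/\ open W /\ W p, adapted_frame g gh W rho r rh &
         forall c W', atlas M c -> open W' -> W' `<=` W -> W' `<=` dom c ->
         [/\ closed_on c W' (fun v => connection c v r rh),
             closed_on c W' (fun v => connection c v rh r) & symmetric_on c W']]) ->
  nabla_flat g gh.
Proof.
move=> Lg Lgh frames c Ac W oW sW u v nu nu_u nu_v nu_uv nu_vu Nu Nv Nuv Nvu p Wp.
have [W0 [rho [r [rh [[oW0 W0p] ad cl]]]]] := frames p.
pose W' := W `&` W0.
have oW' : open W' by exact: openI.
have W'p : W' p by [].
have sW'0 : W' `<=` W0 by exact: subIsetr.
have sW' : W' `<=` W by exact: subIsetl.
have sW'd : W' `<=` dom c := subset_trans sW' sW.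
have [cl1 cl2 sy] := cl c W' Ac oW' sW'0 sW'd.
have ad' := adapted_frame_subset sW'0 ad.
have Nu' := nabla_subset sW' Nu; have Nv' := nabla_subset sW' Nv.
have Nuv' := nabla_subset sW' Nuv; have Nvu' := nabla_subset sW' Nvu.
have E1 := nabla_pairing_commute Lg oW' sW'd Ac ad' W'p cl1 sy Nu' Nv' Nuv' Nvu'.
have E2 := nabla_pairing_commute Lgh oW' sW'd Ac (adapted_frame_swap ad') W'p cl2 sy
  (nabla_swap Nu') (nabla_swap Nv') (nabla_swap Nuv') (nabla_swap Nvu').
apply: (mem_cap_orthogonal Lg Lgh ad' W'p _ E1 E2).
have [[_ sg1] _ _] := Nvu'; have [_ [_ sg2] _] := Nuv'; have [_ [_ sg3] _] := Nvu'.
by have := memvB (sg2 p W'p) (sg3 p W'p).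
Qed.

End LegendreFlatness.

(** * Frames adapted to the cube *)

Section CommonFrame.
Variables (R : realType) (m : nat) (M : manifold R m).
Local Notation V := ('rV[R]_(m + 2 + 2)).

(** Since [I] is finite, the domains of the individual local sections share a neighbourhood of [p],
    whose interior serves all of them. *)
Lemma common_line_frame (I : finType) (L : I -> M -> {vspace V}) :
  (forall i, smooth_bundle 1 (L i)) ->
  forall p, exists (W : set M) (s : I -> M -> V),
    [/\ open W, W p, forall i, smooth_map W (s i) &
        forall i q, W q -> L i q = <[s i q]>%VS /\ s i q != 0].
Proof.
move=> sL p.
have H i : exists Ws : set M * (M -> V), [/\ open Ws.1, Ws.1 p, smooth_map Ws.1 Ws.2 &
    forall q, Ws.1 q -> L i q = <[Ws.2 q]>%VS].
  have [_ /(_ p)[W [s [oW Wp ss E]]]] := sL i.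
  exists (W, s ord0); split=> //=; first exact/smooth_onP.
  move=> q Wq; rewrite E //; apply/eqP; rewrite eqEsubv; apply/andP; split.
    by apply/span_subvP => x /mapP[l _ ->]; rewrite (ord1 l) memv_line.
  by rewrite -memvE memv_span //; apply/mapP; exists ord0; rewrite ?mem_enum.
have [Ws HW] := choice H.
pose W0 := [set q | forall i, (Ws i).1 q].
have nW0 : nbhs p W0.
  apply: filter_forall => i; have [oW Wp _ _] := HW i.
  exact: open_nbhs_nbhs.
have sW i : interior W0 `<=` (Ws i).1.
  by apply: (subset_trans (@interior_subset _ W0)) => q /(_ i).
exists (interior W0), (fun i => (Ws i).2); split.
- exact: open_interior.
- exact: nW0.
- by move=> i; have [_ _ ss _] := HW i; apply: smooth_map_subset (sW i) ss.
- move=> i q /(sW i) Wq; have [_ _ _ E] := HW i.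
  have LE := E q Wq; split=> //; have := (sL i).1 q.
  by rewrite LE dim_vline; case: eqP.
Qed.

End CommonFrame.

(** The three indices add up to 3, so this is the remaining index for distinct [i] and [j]; for
    equal arguments the value carries no meaning. *)
Definition third (i j : 'I_3) : 'I_3 := inord (3 - (i + j)).

Lemma third_neq (i j : 'I_3) : i != j -> third i j != i /\ third i j != j.
Proof.
by move: i j => [[|[|[|//]]] ?] [[|[|[|//]]] ?] //= _; rewrite -!val_eqE /= inordK.
Qed.

Lemma third_unique (i j k : 'I_3) : i != j -> j != k -> i != k -> third i j = k.
Proof.
move: i j k => [[|[|[|//]]] ?] [[|[|[|//]]] ?] [[|[|[|//]]] ?] //= _ _ _;
  by apply: val_inj; rewrite /= inordK.
Qed.

Lemma sum_I3 (V : zmodType) (F : 'I_3 -> V) i j k :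
  i != j -> j != k -> i != k -> \sum_(l < 3) F l = F i + F j + F k.
Proof.
move=> ij jk ik; rewrite (bigD1 i) //= (bigD1 j) 1?eq_sym //= (bigD1 k) /=.
  rewrite big1 ?addr0 ?addrA // => l /andP[/andP[li lj] lk].
  have li' : i != l by rewrite eq_sym.
  have jl : j != l by rewrite eq_sym.
  have := third_unique ij jl li'; rewrite (third_unique ij jk ik) => kl.
  by rewrite kl eqxx in lk.
by rewrite ![k == _]eq_sym ik jk.
Qed.

(** * Normalised sections of the hexagon of lines *)

Section CubeFrame.
Variables (R : realType) (m : nat) (M : manifold R m).
Local Notation V := ('rV[R]_(m + 2 + 2)).
Variables (f : M -> {vspace V}) (fh_ f_ : 'I_3 -> M -> {vspace V}).
Hypothesis quads : forall i j k : 'I_3, i != j -> j != k -> i != k ->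
  Bianchi_quadrilateral f (fh_ i) (f_ j) (fh_ k).
Hypothesis fi_disjoint : forall i j : 'I_3, i != j ->
  forall p : M, (f_ i p :&: f_ j p)%VS = 0%VS.

Lemma other_index (i : 'I_3) : exists j, i != j.
Proof.
by exists (if i == 0 then 1 else 0); case: (eqVneq i 0) => [->|].
Qed.

Lemma Ribaucour_f_fh i : Ribaucour_pair f (fh_ i).
Proof.
have [j ij] := other_index i; have [ki kj] := third_neq ij.
have jk : j != third i j by rewrite eq_sym.
have ik : i != third i j by rewrite eq_sym.
by have [[]] := quads ij jk ik.
Qed.

Lemma Ribaucour_fj_fhi i j : i != j -> Ribaucour_pair (f_ j) (fh_ i).
Proof.
move=> ij; have [ki kj] := third_neq ij.
have jk : j != third i j by rewrite eq_sym.
have ik : i != third i j by rewrite eq_sym.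
by have [_ []] := quads ij jk ik.
Qed.

Lemma isotropic_f p : isotropic (f p).
Proof. by have [[[_ H]]] := Ribaucour_f_fh ord0. Qed.

Lemma isotropic_fh i p : isotropic (fh_ i p).
Proof. by have [_ [[_ H]]] := Ribaucour_f_fh i. Qed.

Lemma isotropic_fi i p : isotropic (f_ i p).
Proof.
have [j ij] := other_index i; have ji : j != i by rewrite eq_sym.
by have [[[_ H]]] := Ribaucour_fj_fhi ji.
Qed.

Lemma dim_f p : \dim (f p) = 2%N.
Proof. by have [[[[H _] _]]] := Ribaucour_f_fh ord0. Qed.

Lemma dim_fh i p : \dim (fh_ i p) = 2%N.
Proof. by have [_ [[[H _] _]]] := Ribaucour_f_fh i. Qed.

Lemma dim_fi i p : \dim (f_ i p) = 2%N.
Proof.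
have [j ij] := other_index i; have ji : j != i by rewrite eq_sym.
by have [[[[H _] _]]] := Ribaucour_fj_fhi ji.
Qed.

(** The diagonal entries [e i i] are unconstrained. The nonzero pairings in the last clause become
    the denominators of the connection forms. *)
Definition cube_frame (W : set M) (e : 'I_3 -> 'I_3 -> M -> V) : Prop :=
  [/\ forall i j, i != j -> smooth_map W (e i j),
      forall q i j, W q -> i != j -> (f_ j q :&: fh_ i q)%VS = <[e i j q]>%VS,
      forall q i j k, W q -> i != j -> j != k -> i != k ->
        (f q :&: fh_ i q)%VS = <[e i j q + e i k q]>%VS,
      forall q i j k, W q -> i != j -> j != k -> i != k ->
        (e i j q + e i k q) + (e j i q + e j k q) + (e k i q + e k j q) = 0 &
      forall q i j k, W q -> i != j -> j != k -> i != k ->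
        metric (e i j q) (e j k q) != 0].

Lemma vline_scale (a : R) (x : V) : a != 0 -> <[a *: x]>%VS = <[x]>%VS.
Proof.
move=> a0; apply/eqP; rewrite eqEsubv -!memvE memvZ ?memv_line //=.
by apply/vlineP; exists a^-1; rewrite scalerA mulVf // scale1r.
Qed.

(** The three lines [f :&: fh_ i] lie in one plane, so their sections can be rescaled to have sum
    zero. Each rescaled section then splits in [fh_ i] along the lines shared with [f_ j] and
    [f_ k], and its components are the [e i j]. All coefficients are quotients of pairings, hence
    smooth. *)
Lemma cube_frame_exists p : exists W e, [/\ open W, W p & cube_frame W e].
Proof.
(* The diagonal pairs index the lines shared with [f], so that all nine lines receive sections over
   one neighbourhood. *)
pose L (ij : 'I_3 * 'I_3) q :=
  if ij.1 == ij.2 then (f q :&: fh_ ij.1 q)%VS else (f_ ij.2 q :&: fh_ ij.1 q)%VS.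
have sL ij : smooth_bundle 1 (L ij).
  case: ij => i j; rewrite /L /=; case: (eqVneq i j) => [_|ij].
    by have [_ _ _ [s [[sb _] _ _ E]] _] := Ribaucour_f_fh i; rewrite E in sb.
  by have [_ _ _ [s [[sb _] _ _ E]] _] := Ribaucour_fj_fhi ij; rewrite E in sb.
have [W [l [oW Wp sl lE]]] := common_line_frame sL p.
pose s i := l (i, i); pose t i j := l (i, j).
have sE i q : W q -> (f q :&: fh_ i q)%VS = <[s i q]>%VS.
  by move=> Wq; have [<- _] := lE (i, i) q Wq; rewrite /L eqxx.
have s0 i q : W q -> s i q != 0 by move=> Wq; have [] := lE (i, i) q Wq.
have tE i j q : i != j -> W q -> (f_ j q :&: fh_ i q)%VS = <[t i j q]>%VS.
  by move=> ij Wq; have [<- _] := lE (i, j) q Wq; rewrite /L /= (negPf ij).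
have t0 i j q : W q -> t i j q != 0 by move=> Wq; have [] := lE (i, j) q Wq.
have sf i q : W q -> s i q \in f q /\ s i q \in fh_ i q.
  by move=> Wq; apply/memv_capP; rewrite sE // memv_line.
have tf i j q : i != j -> W q -> t i j q \in f_ j q /\ t i j q \in fh_ i q.
  by move=> ij Wq; apply/memv_capP; rewrite tE // memv_line.
(* These are opposite edges of the quadrilateral [f], [fh_ i], [f_ j], [fh_ k]. *)
have nonorth i j k q : W q -> i != j -> j != k -> i != k -> metric (s i q) (t k j q) != 0.
  move=> Wq ij jk ik; have kj : k != j by rewrite eq_sym.
  have [_ _ dc fne] := quads ij jk ik.
  apply: (@quadrilateral_nonorthogonal _ _ (f q) (fh_ i q) (f_ j q) (fh_ k q)
            (s i q) (s k q) (t i j q)); rewrite ?dim_f ?dim_fi ?sE ?s0 ?t0 ?tE ?memv_line //.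
  - exact: isotropic_f.
  - exact: isotropic_fi.
  - exact: isotropic_fh.
  - exact: isotropic_fh.
  - by rewrite -!sE //; apply: dc.
have st0 i j q : W q -> i != j -> metric (s i q) (t i j q) = 0.
  by move=> Wq ij; apply: (isotropic_fh (i := i) (p := q)); [case: (sf i q Wq)|case: (tf i j q ij Wq)].
have tt0 i j k q : W q -> i != k -> j != k -> metric (t i k q) (t j k q) = 0.
  by move=> Wq ik jk; apply: (isotropic_fi (i := k) (p := q));
    [case: (tf i k q ik Wq)|case: (tf j k q jk Wq)].
have s_indep i k q : W q -> i != k -> s i q \notin <[s k q]>%VS.
  move=> Wq ik; have [ji jk] := third_neq ik.
  apply/negP => /vlineP[a sia].
  have := nonorth i (third i k) k q Wq; rewrite ![_ == third _ _]eq_sym => /(_ ji jk ik).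
  by rewrite sia metricZl st0 ?mulr0 ?eqxx // eq_sym.
(* Pairing with [t k j] isolates [x], because [s k] and [t k j] both lie in the null plane
   [fh_ k]. *)
have st1 i j k q x y : W q -> i != j -> j != k -> i != k ->
    s i q = x *: s j q + y *: s k q ->
    [/\ x != 0, metric (s j q) (t k j q) != 0 &
        x = metric (s i q) (t k j q) * (metric (s j q) (t k j q))^-1].
  move=> Wq ij jk ik sE'.
  have kj : k != j by rewrite eq_sym.
  have nz := nonorth i j k q Wq ij jk ik.
  have xE : metric (s i q) (t k j q) = x * metric (s j q) (t k j q).
    by rewrite sE' metricDl !metricZl st0 // mulr0 addr0.
  have := nz; rewrite xE mulf_eq0 negb_or => /andP[x0 sj0].
  by split=> //; rewrite -mulrA divff // mulr1.
have ss i : smooth_map W (s i) := sl (i, i).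
have st i j : smooth_map W (t i j) := sl (i, j).
pose a1 q := metric (s 0 q) (t 2 1 q) * (metric (s 1 q) (t 2 1 q))^-1.
pose a2 q := metric (s 0 q) (t 1 2 q) * (metric (s 2 q) (t 1 2 q))^-1.
have span_s i j k q : W q -> i != j -> j != k -> i != k ->
    exists x y, s i q = x *: s j q + y *: s k q.
  move=> Wq ij jk ik; apply: mem_plane.
  have [sfj _] := sf j q Wq; have [sfk _] := sf k q Wq; have [sfi _] := sf i q Wq.
  by rewrite -(plane_span (dim_f q) sfj sfk (s0 k q Wq) (s_indep j k q Wq jk)).
have n01 : (0 : 'I_3) != 1 by []. have n12 : (1 : 'I_3) != 2 by [].
have n02 : (0 : 'I_3) != 2 by []. have n21 : (2 : 'I_3) != 1 by [].
have rel q : W q -> [/\ s 0 q = a1 q *: s 1 q + a2 q *: s 2 q, a1 q != 0 & a2 q != 0].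
  move=> Wq; have [x [y sE']] := span_s 0 1 2 q Wq n01 n12 n02.
  have [x0 _ xE] := st1 0 1 2 q x y Wq n01 n12 n02 sE'.
  rewrite addrC in sE'.
  have [y0 _ yE] := st1 0 2 1 q y x Wq n02 n21 n01 sE'.
  by rewrite /a1 /a2 -xE -yE addrC.
have sjt q : W q -> metric (s 1 q) (t 2 1 q) != 0 /\ metric (s 2 q) (t 1 2 q) != 0.
  move=> Wq; have [x [y sE']] := span_s 0 1 2 q Wq n01 n12 n02.
  have [_ ? _] := st1 0 1 2 q x y Wq n01 n12 n02 sE'.
  rewrite addrC in sE'.
  by have [_ ? _] := st1 0 2 1 q y x Wq n02 n21 n01 sE'.
have sa1 : smooth_map W a1.
  apply: smooth_map_mul => //; first exact: smooth_map_metric.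
  apply: smooth_mapV => //; first by move=> q /sjt[].
  exact: smooth_map_metric.
have sa2 : smooth_map W a2.
  apply: smooth_map_mul => //; first exact: smooth_map_metric.
  apply: smooth_mapV => //; first by move=> q /sjt[].
  exact: smooth_map_metric.
(* These factors turn [s 0 = a1 s 1 + a2 s 2] into a vanishing sum. *)
pose c (i : 'I_3) : M -> R := if i == 0 then cst (-1) else if i == 1 then a1 else a2.
have sc i : smooth_map W (c i).
  by rewrite /c; case: ifP => // _; [exact: smooth_map_cst|case: ifP].
have c0 i q : W q -> c i q != 0.
  move=> /rel[_ ? ?]; rewrite /c; case: ifP => // _; last by case: ifP.
  by rewrite oppr_eq0 oner_eq0.
pose sig i q := c i q *: s i q.
have ssig i : smooth_map W (sig i) by apply: smooth_map_scale.
have sumsig q : W q -> \sum_(l < 3) sig l q = 0.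
  move=> /rel[sE' _ _]; rewrite (sum_I3 _ n01 n12 n02) /sig /c /= sE'.
  by rewrite scaleN1r -addrA addNr.
have sigf i q : W q -> sig i q \in fh_ i q.
  by move=> Wq; rewrite memvZ //; case: (sf i q Wq).
have sigt i j k q : W q -> i != j -> j != k -> i != k -> metric (sig i q) (t k j q) != 0.
  by move=> Wq ij jk ik; rewrite metricZl mulf_neq0 ?c0 ?nonorth.
(* Pairing with [t j k] isolates [x], because [t i k] and [t j k] both lie in the null plane
   [f_ k]. *)
have coef i j k q x y : W q -> i != j -> j != k -> i != k ->
    sig i q = x *: t i j q + y *: t i k q ->
    [/\ x != 0, metric (t i j q) (t j k q) != 0 &
        x = metric (sig i q) (t j k q) * (metric (t i j q) (t j k q))^-1].
  move=> Wq ij jk ik sE'; have kj : k != j by rewrite eq_sym.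
  have nz := sigt i k j q Wq ik kj ij.
  have xE : metric (sig i q) (t j k q) = x * metric (t i j q) (t j k q).
    by rewrite sE' metricDl !metricZl tt0 // mulr0 addr0.
  have := nz; rewrite xE mulf_eq0 negb_or => /andP[x0 tt].
  by split=> //; rewrite -mulrA divff // mulr1.
have span_t i j k q : W q -> i != j -> j != k -> i != k ->
    exists x y, sig i q = x *: t i j q + y *: t i k q.
  move=> Wq ij jk ik; apply: mem_plane.
  have [tj th] := tf i j q ij Wq; have [tk tkh] := tf i k q ik Wq.
  rewrite -(plane_span (dim_fh i q) th tkh (t0 i k q Wq)) ?sigf //.
  (* If [t i j] and [t i k] were proportional, [t i j] would lie in [f_ j :&: f_ k], which is
     zero. *)
  apply/negP => /vlineP[x tx]; have := t0 i j q Wq.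
  by rewrite -memv0 -(fi_disjoint jk q) memv_cap tj tx memvZ.
(* The explicit quotient replaces the pointwise coefficients, whose dependence on the point would
   otherwise be uncontrolled. *)
pose x i j q := metric (sig i q) (t j (third i j) q) *
  (metric (t i j q) (t j (third i j) q))^-1.
have xP i j k q : W q -> i != j -> j != k -> i != k ->
    [/\ x i j q != 0, metric (t i j q) (t j k q) != 0 &
        sig i q = x i j q *: t i j q + x i k q *: t i k q].
  move=> Wq ij jk ik; have kj : k != j by rewrite eq_sym.
  have [a [b sE']] := span_t i j k q Wq ij jk ik.
  have [a0 tt aE] := coef i j k q a b Wq ij jk ik sE'.
  have sE2 := sE'; rewrite addrC in sE2.
  have [b0 _ bE] := coef i k j q b a Wq ik kj ij sE2.
  by rewrite /x (third_unique ij jk ik) (third_unique ik kj ij) -aE -bE.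
exists W, (fun i j q => x i j q *: t i j q); split=> //; split.
- move=> i j ij; have [ki kj] := third_neq ij.
  have jk : j != third i j by rewrite eq_sym.
  have ik : i != third i j by rewrite eq_sym.
  apply: smooth_map_scale => //; apply: smooth_map_mul => //.
    exact: smooth_map_metric.
  apply: smooth_mapV => //; first by move=> q Wq; have [] := xP i j _ q Wq ij jk ik.
  exact: smooth_map_metric.
- move=> q i j Wq ij; have [ki kj] := third_neq ij.
  have jk : j != third i j by rewrite eq_sym.
  have ik : i != third i j by rewrite eq_sym.
  by rewrite vline_scale ?tE //; have [] := xP i j _ q Wq ij jk ik.
- move=> q i j k Wq ij jk ik; have [_ _ <-] := xP i j k q Wq ij jk ik.
  by rewrite sE // vline_scale // c0.
- move=> q i j k Wq ij jk ik.
  have ji : j != i by rewrite eq_sym.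
  have kj : k != j by rewrite eq_sym.
  have ki : k != i by rewrite eq_sym.
  have [_ _ <-] := xP i j k q Wq ij jk ik.
  have [_ _ <-] := xP j i k q Wq ji ik jk.
  have [_ _ <-] := xP k i j q Wq ki ij kj.
  by rewrite -(sum_I3 (fun l => sig l q) ij jk ik) sumsig.
- move=> q i j k Wq ij jk ik.
  have ki : k != i by rewrite eq_sym.
  have ji : j != i by rewrite eq_sym.
  have [x0 tt _] := xP i j k q Wq ij jk ik.
  have [x0' _ _] := xP j k i q Wq jk ki ji.
  by rewrite metricZl metricZr; apply: mulf_neq0 => //; apply: mulf_neq0.
Qed.

End CubeFrame.

(** * Bundles from local frames, and linear algebra of the hexagon *)

Section SmoothBundles.
Variables (R : realType) (m : nat) (M : manifold R m).
Local Notation V := ('rV[R]_(m + 2 + 2)).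
Implicit Types (F : M -> {vspace V}).

Lemma smooth_bundle_line F :
  (forall p, exists (W : set M) (s : M -> V), [/\ open W, W p, smooth_map W s &
     forall q, W q -> F q = <[s q]>%VS /\ s q != 0]) -> smooth_bundle 1 F.
Proof.
move=> H; split=> p; have [W [s [oW Wp ss E]]] := H p.
  by have [-> s0] := E p Wp; rewrite dim_vline s0.
exists W, (fun=> s); split=> // [_|q Wq]; first exact/smooth_onP.
have [-> _] := E q Wq; apply/eqP; rewrite eqEsubv; apply/andP; split.
  by rewrite -memvE memv_span //; apply/mapP; exists ord0; rewrite ?mem_enum.
by apply/span_subvP => x /mapP[l _ ->]; rewrite memv_line.
Qed.

Lemma smooth_bundle_plane F : (forall p, \dim (F p) = 2%N) ->
  (forall p, exists (W : set M) (s0 s1 : M -> V),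
     [/\ open W, W p, smooth_map W s0, smooth_map W s1 &
     forall q, W q -> F q = (<[s0 q]> + <[s1 q]>)%VS]) -> smooth_bundle 2 F.
Proof.
move=> dF H; split=> // p; have [W [s0 [s1 [oW Wp ss0 ss1 E]]]] := H p.
exists W, (fun i => if i == ord0 then s0 else s1); split=> // [i|q Wq].
  by apply/smooth_onP; case: ifP.
rewrite E //; apply/eqP; rewrite eqEsubv subv_add -!memvE; apply/andP; split.
  apply/andP; split; rewrite memv_span //; apply/mapP.
    by exists ord0; rewrite ?mem_enum.
  by exists ord_max; rewrite ?mem_enum.
apply/span_subvP => x /mapP[l _ ->].
by case: ifP => _; [exact: mem_planel|exact: mem_planer].
Qed.

(* The vectors sum to zero around a hexagon [ij, ik, jk, ji, ki, kj] whose
   neighbours are orthogonal; [d] stands for a derivative of [e]. *)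
Lemma metric_hexagon (eij eik ejk eji eki ekj dij dik djk dji dki dkj : V) :
  (eij + eik) + (eji + ejk) + (eki + ekj) = 0 ->
  (dij + dik) + (dji + djk) + (dki + dkj) = 0 ->
  metric (dki + dkj) (eji + ejk) = 0 ->
  metric dkj eij = 0 -> metric dkj eki = 0 -> metric dkj ekj = 0 ->
  metric dik ejk = 0 -> metric dji ejk = 0 -> metric djk ejk = 0 ->
  metric dki eji = 0 -> metric dij eik = 0 ->
  metric (dij + dkj) (eik + ejk) = 0.
Proof.
move=> /(congr1 (metric dkj)); rewrite metric0r => row.
move=> /(congr1 (fun x => metric x ejk)); rewrite metric0l => col Lf.
move=> h1 h2 h3 h4 h5 h6 h7 h8.
move: row col Lf; rewrite !metricDl !metricDr h1 h2 h3 h4 h5 h6 h7 h8.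
move: (metric dkj eik) (metric dkj ejk) (metric dkj eji) (metric dij ejk) (metric dki ejk).
by move=> x1 x2 x3 x4 x5 row col Lf; lra.
Qed.

Lemma notin_line_metric (u v z : V) :
  u != 0 -> metric u z = 0 -> metric v z != 0 -> u \notin <[v]>%VS.
Proof.
move=> u0 uz vz; apply/negP => /vlineP[a ua]; move/eqP: uz.
rewrite ua metricZl mulf_eq0 (negPf vz) orbF => /eqP a0.
by rewrite ua a0 scale0r eqxx in u0.
Qed.

Lemma eq_closed_on c (W : set M) (k k' : 'rV[R]_m -> M -> R) :
  open W -> W `<=` dom c -> (forall v, {in W, k v =1 k' v}) ->
  closed_on c W k -> closed_on c W k'.
Proof.
move=> oW sW kk' cl u v p Wp.
rewrite -(eq_on_dscal u oW (kk' v) Wp (sW p Wp)).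
by rewrite -(eq_on_dscal v oW (kk' u) Wp (sW p Wp)); apply: cl.
Qed.

End SmoothBundles.

(** * The eighth vertex *)

Section CubeCompletion.
Variables (R : realType) (m : nat) (M : manifold R m).
Local Notation V := ('rV[R]_(m + 2 + 2)).
Variables (f : M -> {vspace V}) (fh_ f_ : 'I_3 -> M -> {vspace V}).
Hypothesis quads : forall i j k : 'I_3, i != j -> j != k -> i != k ->
  Bianchi_quadrilateral f (fh_ i) (f_ j) (fh_ k).
Hypothesis fi_disjoint : forall i j : 'I_3, i != j ->
  forall p : M, (f_ i p :&: f_ j p)%VS = 0%VS.
Hypothesis fi_generic : forall i j k : 'I_3, i != j -> j != k -> i != k ->
  forall p : M, ~~ (f_ i p <= f_ j p + f_ k p)%VS.

(** Frame-free, hence global. Two of the lines [f_ j :&: (f_ i + f_ k)] suffice, since the third is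
    spanned by [rho e 2], which is minus the sum of the generators of the other two. *)
Definition eighth (p : M) : {vspace V} :=
  (f_ 0%R p :&: (f_ 1%R p + f_ 2%R p) + f_ 1%R p :&: (f_ 2%R p + f_ 0%R p))%VS.

(** Written as a sum so that it depends on [j] alone, without naming or ordering the other two
    indices. *)
Definition rho (e : 'I_3 -> 'I_3 -> M -> V) (j : 'I_3) (q : M) : V :=
  \sum_(i < 3 | i != j) e i j q.

Section Frame.
Variables (W : set M) (e : 'I_3 -> 'I_3 -> M -> V).
Hypotheses (oW : open W) (fr : cube_frame f fh_ f_ W e).

Section Indices.
Variables i j k : 'I_3.
Hypotheses (ij : i != j) (jk : j != k) (ik : i != k).
Let ji : j != i. Proof. by rewrite eq_sym. Qed.
Let kj : k != j. Proof. by rewrite eq_sym. Qed.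
Let ki : k != i. Proof. by rewrite eq_sym. Qed.

Lemma rhoE q : rho e j q = e i j q + e k j q.
Proof. by rewrite /rho big_mkcond (sum_I3 _ ij jk ik) /= eqxx ij kj addr0. Qed.

Lemma smooth_e : smooth_map W (e i j). Proof. by case: fr => H _ _ _ _; apply: H. Qed.

Lemma e_fi q : W q -> e i j q \in f_ j q.
Proof.
case: fr => _ H _ _ _ Wq; have := memv_line (e i j q).
by rewrite -H // => /memv_capP[].
Qed.

Lemma e_fh q : W q -> e i j q \in fh_ i q.
Proof.
case: fr => _ H _ _ _ Wq; have := memv_line (e i j q).
by rewrite -H // => /memv_capP[].
Qed.

End Indices.

Lemma smooth_rho j : smooth_map W (rho e j).
Proof.
have [k jk] := other_index j; have [ij ik] := third_neq jk.
have -> : rho e j = fun q => e (third j k) j q + e k j q.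
  by apply/funext => q; apply: rhoE.
by apply: smooth_map_addv => //; apply: smooth_e => //; rewrite eq_sym.
Qed.

Lemma rho_fi q j : W q -> rho e j q \in f_ j q.
Proof. by move=> Wq; apply: memv_suml => i ij; apply: e_fi. Qed.

Section Pointwise.
Variables (q : M) (i j k : 'I_3).
Hypotheses (Wq : W q) (ij : i != j) (jk : j != k) (ik : i != k).
Let ji : j != i. Proof. by rewrite eq_sym. Qed.
Let kj : k != j. Proof. by rewrite eq_sym. Qed.
Let ki : k != i. Proof. by rewrite eq_sym. Qed.

Lemma metric_e_fh : metric (e i j q) (e i k q) = 0.
Proof. by apply: (isotropic_fh quads (i := i) (p := q)); apply: e_fh. Qed.

Lemma metric_e_fi : metric (e i j q) (e k j q) = 0.
Proof. by apply: (isotropic_fi quads (i := j) (p := q)); apply: e_fi. Qed.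

Lemma metric_e_rho : metric (e i j q) (rho e k q) = metric (e i j q) (e j k q).
Proof. by rewrite (rhoE ik kj ij) metricDr metric_e_fh add0r. Qed.

Lemma metric_e_rho_neq0 : metric (e i j q) (rho e k q) != 0.
Proof. by rewrite metric_e_rho; case: fr => _ _ _ _ H; apply: H. Qed.

Lemma rho_sum : rho e i q + rho e j q + rho e k q = 0.
Proof.
rewrite (rhoE ji ik jk) (rhoE ij jk ik) (rhoE ik kj ij).
case: fr => _ _ _ H _; rewrite -(H q i j k Wq ij jk ik).
set a := e i j q; set b := e i k q; set x := e j i q; set y := e j k q.
set z := e k i q; set w := e k j q.
by rewrite (AC (2*2*2) ((3*5)*(1*6)*(2*4))).
Qed.

End Pointwise.

Section Rho.
Variables (q : M) (i j k : 'I_3).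
Hypotheses (Wq : W q) (ij : i != j) (jk : j != k) (ik : i != k).
Let ji : j != i. Proof. by rewrite eq_sym. Qed.
Let kj : k != j. Proof. by rewrite eq_sym. Qed.
Let ki : k != i. Proof. by rewrite eq_sym. Qed.

Lemma rhoNE : rho e j q = - rho e i q - rho e k q.
Proof.
apply/eqP; rewrite -opprD -addr_eq0 addrCA addrA; apply/eqP.
exact: rho_sum Wq ij jk ik.
Qed.

Lemma rho_neq0 : rho e k q != 0.
Proof.
apply/eqP => r0; have := metric_e_rho_neq0 Wq ij jk ik.
by rewrite r0 metric0r eqxx.
Qed.

Lemma metric_rho_fi x : x \in f_ j q -> metric (rho e j q) x = 0.
Proof. by move=> xf; apply: (isotropic_fi quads (i := j) (p := q)) => //; apply: rho_fi. Qed.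

(* [rho_i = - (rho_j + rho_k)] is null, as are [rho_j] and [rho_k]. *)
Lemma metric_rho : metric (rho e j q) (rho e k q) = 0.
Proof.
have null l : metric (rho e l q) (rho e l q) = 0.
  by apply: (isotropic_fi quads (i := l) (p := q)); apply: rho_fi.
have := null i; have -> : rho e i q = - rho e j q - rho e k q.
  by rewrite rhoNE opprB opprK addrAC subrr add0r.
have polar (a b : V) : metric (- a - b) (- a - b) =
    metric a a + metric b b + metric a b *+ 2.
  by rewrite !(metricDl, metricDr, metricNl, metricNr) [metric b a]metricC; ring.
by rewrite polar !null !add0r => /eqP; rewrite mulrn_eq0 /= => /eqP.
Qed.

Lemma rho_notin : rho e j q \notin <[rho e k q]>%VS.
Proof.
have kf := rho_fi k Wq; have jf := rho_fi j Wq.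
apply/negP => /vlineP[a rE]; have := metric_e_rho_neq0 Wq ki ij kj.
suff -> : rho e j q = 0 by rewrite metric0r eqxx.
by apply/eqP; rewrite -memv0 -(fi_disjoint jk q) memv_cap jf rE memvZ.
Qed.

(** Genericity makes the intersection at most a line, and it contains the nonzero vector
    [rho e j = - rho e i - rho e k]. *)
Lemma fi_cap_rho : (f_ j q :&: (f_ i q + f_ k q))%VS = <[rho e j q]>%VS.
Proof.
have r0 : rho e j q != 0.
  by apply: contraNneq rho_notin => ->; rewrite mem0v.
apply: line_of_proper => //; first exact: dim_fi quads _ _.
  exact: fi_generic.
rewrite memv_cap rho_fi //= rhoNE memv_add ?memvN ?rho_fi //.
Qed.

End Rho.

Let n01 : (0 : 'I_3) != 1. Proof. by []. Qed.
Let n12 : (1 : 'I_3) != 2. Proof. by []. Qed.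
Let n02 : (0 : 'I_3) != 2. Proof. by []. Qed.
Let n10 : (1 : 'I_3) != 0. Proof. by []. Qed.
Let n21 : (2 : 'I_3) != 1. Proof. by []. Qed.
Let n20 : (2 : 'I_3) != 0. Proof. by []. Qed.

Lemma eighth_rho01 q : W q -> eighth q = (<[rho e 0%R q]> + <[rho e 1%R q]>)%VS.
Proof.
move=> Wq; rewrite /eighth (fi_cap_rho Wq n10 n02 n12).
by rewrite (fi_cap_rho Wq n21 n10 n20).
Qed.

Lemma dim_eighth_on q : W q -> \dim (eighth q) = 2%N.
Proof.
move=> Wq; rewrite eighth_rho01 //; apply: plane_dim.
  exact: (rho_neq0 Wq n02 n21 n01).
exact: (rho_notin Wq n20 n01 n21).
Qed.

Lemma rho_eighth l q : W q -> rho e l q \in eighth q.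
Proof.
move=> Wq; rewrite eighth_rho01 //.
have [->|l0] := eqVneq l 0; first exact: mem_planel.
have [->|l1] := eqVneq l 1; first exact: mem_planer.
have l0' : 0 != l by rewrite eq_sym.
rewrite (rhoNE Wq l0' l1 n01).
by rewrite memv_add // memvN memv_line.
Qed.

Lemma eighth_rho j k q : W q -> j != k ->
  eighth q = (<[rho e j q]> + <[rho e k q]>)%VS.
Proof.
move=> Wq jk; have [ij ik] := third_neq jk.
apply: plane_span; rewrite ?rho_eighth ?dim_eighth_on //.
  by apply: (rho_neq0 Wq ij jk ik).
exact: (rho_notin Wq ij jk ik).
Qed.

Lemma isotropic_eighth_on q : W q -> isotropic (eighth q).
Proof.
move=> Wq x y; rewrite eighth_rho01 // => /mem_plane[a [b ->]] /mem_plane[a' [b' ->]].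
have r01 := metric_rho Wq n20 n01 n21; have r10 := metric_rho Wq n21 n10 n20.
have rr l : metric (rho e l q) (rho e l q) = 0.
  by apply: metric_rho_fi => //; apply: rho_fi.
by rewrite !(metricDl, metricDr, metricZl, metricZr) r01 r10 !rr !(mulr0, addr0).
Qed.

(** An element [a rho_j + b rho_k] of [f_ j] puts [b rho_k] into [f_ j :&: f_ k], which is zero. *)
Lemma fi_cap_eighth j q : W q -> (f_ j q :&: eighth q)%VS = <[rho e j q]>%VS.
Proof.
move=> Wq; have [k jk] := other_index j.
apply/eqP; rewrite eqEsubv -memvE memv_cap rho_fi // rho_eighth // !andbT.
apply/subvP => x /memv_capP[xf]; rewrite (eighth_rho Wq jk).
move=> /mem_plane[a [b xE]]; rewrite xE.
have : b *: rho e k q \in (f_ j q :&: f_ k q)%VS.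
  rewrite memv_cap [X in _ && X]memvZ ?rho_fi // andbT.
  by rewrite -(addKr (a *: rho e j q) (b *: rho e k q)) -xE addrC memvB // memvZ // rho_fi.
rewrite fi_disjoint // memv0 => /eqP ->.
by rewrite addr0 memvZ // memv_line.
Qed.

Lemma Legendre_f : Legendre f.
Proof. by case: (Ribaucour_f_fh quads 0). Qed.

Lemma Legendre_fh i : Legendre (fh_ i).
Proof. by case: (Ribaucour_f_fh quads i). Qed.

Lemma Legendre_fi i : Legendre (f_ i).
Proof.
have [j ij] := other_index i; have ji : j != i by rewrite eq_sym.
by case: (Ribaucour_fj_fhi quads ji).
Qed.

(** * Derivatives of the cube frame and comparison of connection forms *)

Section Derivative.
Variables (i j k : 'I_3).
Hypotheses (ij : i != j) (jk : j != k) (ik : i != k).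
Let ji : j != i. Proof. by rewrite eq_sym. Qed.
Let kj : k != j. Proof. by rewrite eq_sym. Qed.
Let ki : k != i. Proof. by rewrite eq_sym. Qed.

Lemma smooth_sigma : smooth_map W (fun q => e i j q + e i k q).
Proof. by apply: smooth_map_addv => //; apply: smooth_e. Qed.

Lemma sigma_f q : W q -> e i j q + e i k q \in f q.
Proof.
move=> Wq; case: fr => _ _ H _ _; have := memv_line (e i j q + e i k q).
by rewrite -(H q i j k Wq ij jk ik) => /memv_capP[].
Qed.

Section At.
Variables (c : chart R m M) (v : 'rV[R]_m) (q : M).
Hypotheses (Ac : atlas M c) (Wq : W q) (dq : dom c q).

Lemma metric_de_fh : metric (dchart c v (e i j) q) (e i k q) = 0.
Proof.
apply: (Legendre_dchart v (Legendre_fh i) oW _ _ _ _ Ac Wq dq).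
- exact: smooth_e.
- exact: smooth_e.
- by move=> r Wr; apply: e_fh.
- by move=> r Wr; apply: e_fh.
Qed.

Lemma metric_de_fi : metric (dchart c v (e i j) q) (e k j q) = 0.
Proof.
apply: (Legendre_dchart v (Legendre_fi j) oW _ _ _ _ Ac Wq dq).
- exact: smooth_e.
- exact: smooth_e.
- by move=> r Wr; apply: e_fi.
- by move=> r Wr; apply: e_fi.
Qed.

Lemma dchart_sigma : dchart c v (fun q => e i j q + e i k q) q =
  dchart c v (e i j) q + dchart c v (e i k) q.
Proof. by apply: (dchartD v Ac _ _ Wq dq); apply: smooth_e. Qed.

Lemma dchart_rho : dchart c v (rho e j) q =
  dchart c v (e i j) q + dchart c v (e k j) q.
Proof.
have -> : rho e j = fun q => e i j q + e k j q.
  by apply/funext => r; rewrite (rhoE ij jk ik).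
by apply: (dchartD v Ac _ _ Wq dq); apply: smooth_e.
Qed.

End At.
End Derivative.

Section Connection.
Variables (i j k : 'I_3) (c : chart R m M).
Hypotheses (ij : i != j) (jk : j != k) (ik : i != k) (Ac : atlas M c).
Let ji : j != i. Proof. by rewrite eq_sym. Qed.
Let kj : k != j. Proof. by rewrite eq_sym. Qed.
Let ki : k != i. Proof. by rewrite eq_sym. Qed.

Lemma dchart_e_sum v q : W q -> dom c q ->
  dchart c v (e i j) q + dchart c v (e i k) q +
  (dchart c v (e j i) q + dchart c v (e j k) q) +
  (dchart c v (e k i) q + dchart c v (e k j) q) = 0.
Proof.
move=> Wq dq.
rewrite -(dchart_sigma ij ik) // -(dchart_sigma ji jk) // -(dchart_sigma ki kj) //.
have si := smooth_sigma ij ik; have sj := smooth_sigma ji jk.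
have sk := smooth_sigma ki kj.
rewrite -(dchartD v Ac si sj Wq dq) -(dchartD v Ac (smooth_map_addv oW si sj) sk Wq dq).
have E : {in W, (fun q => (e i j q + e i k q) + (e j i q + e j k q)
    + (e k i q + e k j q)) =1 cst 0}.
  by move=> r; rewrite inE => Wr; case: fr => _ _ _ H _; rewrite (H r i j k Wr).
by rewrite (eq_on_dchart v oW E Wq dq) dchart_cst.
Qed.

(** This is the Legendre condition for [eighth] in the frame of the [rho e j]. The Legendre
    conditions of [f], the [fh_ i] and the [f_ j] supply the vanishing pairings required by
    [metric_hexagon]. *)
Lemma metric_drho v q : W q -> dom c q ->
  metric (dchart c v (rho e j) q) (rho e k q) = 0.
Proof.
move=> Wq dq.
have fh a b b' : a != b -> a != b' -> metric (dchart c v (e a b) q) (e a b' q) = 0.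
  by move=> ab ab'; apply: metric_de_fh.
have fi a b a' : a != b -> a' != b -> metric (dchart c v (e a b) q) (e a' b q) = 0.
  by move=> ab a'b; apply: metric_de_fi; rewrite // eq_sym.
have eS : (e i j q + e i k q) + (e j i q + e j k q) + (e k i q + e k j q) = 0.
  by case: fr => _ _ _ H _; apply: H.
have Lf := Legendre_dchart v Legendre_f oW (smooth_sigma ki kj) (smooth_sigma ji jk)
    (sigma_f ki ij kj) (sigma_f ji ik jk) Ac Wq dq.
rewrite (dchart_sigma ki kj v Ac Wq dq) in Lf.
rewrite (dchart_rho ij jk ik v Ac Wq dq) (rhoE ik kj ij).
have dS := dchart_e_sum v Wq dq.
exact: (metric_hexagon eS dS Lf (fi _ _ _ kj ij) (fh _ _ _ kj ki) (fh _ _ _ kj kj)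
  (fi _ _ _ ik jk) (fh _ _ _ ji jk) (fh _ _ _ jk jk) (fi _ _ _ ki ji) (fh _ _ _ ij ik)).
Qed.

(** Both sides equal [(d e_ij, e_jk) / (e_ij, e_jk)]: on the left [e_ik] drops out since it shares
    [f_ k] with [e_jk], on the right since it shares [fh_ i] with [e_ij]. *)
Lemma connection_e_rho v q : W q -> dom c q ->
  connection c v (fun q => e i j q + e i k q) (e j k) q =
  connection c v (e i j) (rho e k) q.
Proof.
move=> Wq dq; rewrite !connectionE dchart_sigma // !metricDl.
rewrite (metric_de_fi ik kj) // (metric_e_fi Wq ik kj) !addr0.
rewrite (metric_e_rho Wq ij jk ik) (rhoE ik kj ij) metricDr.
by rewrite (metric_de_fh ij ik) // add0r.
Qed.

Lemma connection_rho_e v q : W q -> dom c q ->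
  connection c v (e j k) (fun q => e i j q + e i k q) q =
  connection c v (rho e k) (e i j) q.
Proof.
move=> Wq dq; rewrite !connectionE (dchart_rho ik kj ij) // !metricDr metricDl.
rewrite (metric_de_fi jk ki) // (metric_e_fi Wq jk ki) !addr0.
rewrite (metric_de_fh ik ij) // add0r [metric (rho e k q) _]metricC.
by rewrite (metric_e_rho Wq ij jk ik) [metric (e j k q) _]metricC.
Qed.

Lemma adapted_f_fh : adapted_frame f (fh_ j) W (fun q => e j i q + e j k q)
  (fun q => e i j q + e i k q) (e j k).
Proof.
split; [exact: smooth_sigma|exact: smooth_sigma|exact: smooth_e|move=> q Wq].
have sj := sigma_f ji ik jk Wq; have si := sigma_f ij jk ik Wq.
have nz : metric (e i j q + e i k q) (e j k q) != 0.
  rewrite metricDl (metric_e_fi Wq ik kj) addr0.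
  by case: fr => _ _ _ _ H; apply: H.
have E : (f q :&: fh_ j q)%VS = <[e j i q + e j k q]>%VS.
  by case: fr => _ _ H _ _; apply: H.
(* Tested against [e k i], which is orthogonal to [e j i] but not to [e j k]. *)
have sj0 : e j i q + e j k q != 0.
  apply/eqP => z; have : metric (e j i q + e j k q) (e k i q) = 0 by rewrite z metric0l.
  rewrite metricDl (metric_e_fi Wq ji ik) add0r; apply/eqP.
  by case: fr => _ _ _ _ H; apply: H.
have si0 : e i j q + e i k q != 0.
  by apply: contraNneq nz => ->; rewrite metric0l.
have ejk0 : e j k q != 0 by apply: contraNneq nz => ->; rewrite metric0r.
have ejkf := e_fh jk Wq.
have sjf : e j i q + e j k q \in fh_ j q by rewrite memvD // e_fh.
have sjejk := isotropic_fh quads sjf ejkf.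
have sjsi := isotropic_f quads sj si.
split=> //.
- apply: plane_span => //; first exact: dim_f quads _.
  exact: notin_line_metric sj0 sjejk nz.
- apply: plane_span => //; first exact: dim_fh quads _ _.
  by apply: notin_line_metric sj0 sjsi _; rewrite metricC.
Qed.

(** Flatness of the known pair [(f, fh_ j)] closes both of its connection forms, which coincide with
    those of the new pair [(f_ j, eighth)]. *)
Lemma closed_connections W' : open W' -> W' `<=` W -> W' `<=` dom c ->
  [/\ closed_on c W' (fun v => connection c v (e i j) (rho e k)),
      closed_on c W' (fun v => connection c v (rho e k) (e i j)) & symmetric_on c W'].
Proof.
move=> oW' sW sd; have [_ _ _ _ fl] := Ribaucour_f_fh quads j.
have ad := adapted_frame_subset sW adapted_f_fh.
have [cl sy] := flat_closed Legendre_f (Legendre_fh j) oW' sd Ac ad fl.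
have [cl' _] := flat_closed (Legendre_fh j) Legendre_f oW' sd Ac
  (adapted_frame_swap ad) (nabla_flat_swap fl).
split=> //.
- apply: eq_closed_on cl => // v q; rewrite inE => W'q.
  by apply: connection_e_rho; [apply: sW|apply: sd].
- apply: eq_closed_on cl' => // v q; rewrite inE => W'q.
  by apply: connection_rho_e; [apply: sW|apply: sd].
Qed.

End Connection.

Lemma adapted_fi_eighth i j k : i != j -> j != k -> i != k ->
  adapted_frame (f_ j) eighth W (rho e j) (e i j) (rho e k).
Proof.
move=> ij jk ik; split; [exact: smooth_rho|exact: smooth_e|exact: smooth_rho|].
move=> q Wq; have nz := metric_e_rho_neq0 Wq ij jk ik.
have kj : k != j by rewrite eq_sym.
have ki : k != i by rewrite eq_sym.
have rj0 : rho e j q != 0 by apply: (rho_neq0 Wq ki ij kj).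
split=> //; [|exact: eighth_rho|exact: fi_cap_eighth].
apply: plane_span; [exact: dim_fi quads _ _|exact: rho_fi|exact: e_fi| |].
  by apply: contraNneq nz => ->; rewrite metric0l.
exact: notin_line_metric rj0 (metric_rho Wq ij jk ik) nz.
Qed.

End Frame.

(** * Existence and uniqueness of the simultaneous transform *)

Lemma dim_eighth p : \dim (eighth p) = 2%N.
Proof.
have [W [e [oW Wp fr]]] := cube_frame_exists quads fi_disjoint p.
exact: dim_eighth_on fr _ Wp.
Qed.

Lemma Legendre_eighth : Legendre eighth.
Proof.
apply: Legendre_of_frame.
  split; last first.
    by move=> p; have [W [e [oW Wp fr]]] := cube_frame_exists quads fi_disjoint p;
      apply: isotropic_eighth_on fr _ Wp.
  apply: smooth_bundle_plane => [p|p]; first exact: dim_eighth.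
  have [W [e [oW Wp fr]]] := cube_frame_exists quads fi_disjoint p.
  exists W, (rho e 0), (rho e 1); split=> //; try exact: smooth_rho fr _.
  by move=> q Wq; apply: eighth_rho01 fr _ Wq.
move=> p; have [W [e [oW Wp fr]]] := cube_frame_exists quads fi_disjoint p.
exists W, (rho e 0), (rho e 1); split=> //; try exact: smooth_rho fr _.
  by move=> q Wq; apply: eighth_rho01 fr _ Wq.
by move=> c v q Ac Wq dq; apply: (metric_drho (i := 2) oW fr).
Qed.

Lemma Ribaucour_eighth j : Ribaucour_pair (f_ j) eighth.
Proof.
have [i ji] := other_index j; have [kj ki] := third_neq ji.
set k := third j i in kj ki; have ij : i != j by rewrite eq_sym.
have jk : j != k by rewrite eq_sym.
have ik : i != k by rewrite eq_sym.
split.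
- exact: Legendre_fi.
- exact: Legendre_eighth.
(* If the planes agreed, the nonzero vector [rho e k] would lie in both [f_ j] and [f_ k]. *)
- move=> p fE; have [W [e [oW Wp fr]]] := cube_frame_exists quads fi_disjoint p.
  have rk : rho e k p \in f_ j p by rewrite fE (rho_eighth fr).
  have : rho e k p \in (f_ j p :&: f_ k p)%VS by rewrite memv_cap rk (rho_fi fr).
  rewrite fi_disjoint // memv0; apply/negP.
  exact: (rho_neq0 fr Wp ij jk ik).
- exists (bundle_cap (f_ j) eighth); split=> //.
  + split; last first.
      by move=> p x y /memv_capP[xf _] /memv_capP[yf _]; apply: (isotropic_fi quads xf yf).
    apply: smooth_bundle_line => p.
    have [W [e [oW Wp fr]]] := cube_frame_exists quads fi_disjoint p.
    exists W, (rho e j); split=> //; first exact: smooth_rho fr _.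
    move=> q Wq; split; first exact: fi_cap_eighth fr _ _ Wq.
    exact: (rho_neq0 fr Wq ki ij kj).
  + by move=> p; apply: capvSl.
  + by move=> p; apply: capvSr.
- apply: flat_of_closed; [exact: Legendre_fi|exact: Legendre_eighth|move=> p].
  have [W [e [oW Wp fr]]] := cube_frame_exists quads fi_disjoint p.
  exists W, (rho e j), (e i j), (rho e k); split=> //.
    exact: adapted_fi_eighth.
  by move=> c W' Ac; apply: (closed_connections oW fr ij jk ik Ac).
Qed.

(** Such an [fh] meets each [f_ i] in a line, and any two of these lines span it because the [f_ i]
    are disjoint. So each line lies in [f_ i :&: (f_ j + f_ k)], and comparing dimensions gives
    equality. *)
Lemma eighth_unique fh : (forall i, Ribaucour_pair (f_ i) fh) -> fh = eighth.
Proof.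
move=> Rfh; apply/funext => p.
have lines i : exists x, [/\ x != 0, x \in f_ i p & x \in fh p].
  have [_ _ _ [s [[[sd _] _] _ _ sE]] _] := Rfh i.
  have := sd p; rewrite sE /bundle_cap => d1.
  exists (vpick (f_ i p :&: fh p)); have := memv_pick (f_ i p :&: fh p).
  rewrite memv_cap => /andP[-> ->]; split=> //.
  by rewrite vpick0 -dimv_eq0 d1.
have [l lP] := choice lines.
have dfh : \dim (fh p) = 2%N by have [_ [[[H _] _] _] _ _ _] := Rfh ord0; apply: H.
have span j k : j != k -> fh p = (<[l j]> + <[l k]>)%VS.
  move=> jk; have [lj0 ljf ljh] := lP j; have [lk0 lkf lkh] := lP k.
  apply: plane_span => //; apply/negP => /vlineP[a lE]; move: lj0.
  by rewrite -memv0 -(fi_disjoint jk p) memv_cap ljf lE memvZ.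
have inE i j k : i != j -> j != k -> i != k -> l i \in (f_ i p :&: (f_ j p + f_ k p))%VS.
  move=> ij jk ik; have [_ lif lih] := lP i; rewrite memv_cap lif /=.
  have [_ ljf _] := lP j; have [_ lkf _] := lP k.
  by move: lih; rewrite (span j k jk); apply/subvP; rewrite addvS // -memvE.
have n01 : (0 : 'I_3) != 1 by []. have n12 : (1 : 'I_3) != 2 by [].
have n02 : (0 : 'I_3) != 2 by []. have n10 : (1 : 'I_3) != 0 by [].
have n20 : (2 : 'I_3) != 0 by [].
apply/eqP; rewrite eqEdim dfh dim_eighth leqnn andbT (span 0 1 n01).
by rewrite /eighth addvS // -memvE; [apply: inE|apply: (inE 1 2 0)].
Qed.

End CubeCompletion.

Theorem theorem3p7 (R : realType) (m : nat) (M : manifold R m)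
    (f : M -> {vspace 'rV[R]_(m + 2 + 2)})
    (fh_ f_ : 'I_3 -> M -> {vspace 'rV[R]_(m + 2 + 2)})
    (f_Legendre : Legendre f)
    (fh_Legendre : forall i, Legendre (fh_ i))
    (fi_Legendre : forall i, Legendre (f_ i))
    (quads : forall i j k : 'I_3, i != j -> j != k -> i != k ->
       Bianchi_quadrilateral f (fh_ i) (f_ j) (fh_ k))
    (fh_generic : forall i j k : 'I_3, i != j -> j != k -> i != k ->
       forall p : M, ~~ (fh_ i p <= fh_ j p + fh_ k p)%VS)
    (fi_disjoint : forall i j : 'I_3, i != j ->
       forall p : M, (f_ i p :&: f_ j p)%VS = 0%VS)
    (fi_generic : forall i j k : 'I_3, i != j -> j != k -> i != k ->
       forall p : M, ~~ (f_ i p <= f_ j p + f_ k p)%VS) :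
  exists! fh : M -> {vspace 'rV[R]_(m + 2 + 2)},
    Legendre fh /\ forall i : 'I_3, Ribaucour_pair (f_ i) fh.
Proof.
exists (eighth f_); split; last first.
  by move=> fh [_ Rfh]; apply/esym/(eighth_unique quads fi_disjoint fi_generic).
split; first exact: Legendre_eighth quads fi_disjoint fi_generic.
exact: Ribaucour_eighth quads fi_disjoint fi_generic.
Qed.
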